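(* Let ${\mathcal R}$ be a similarity relation, $\mu$ a cut value, and $t,s$ higher-order patterns. If there exists an $({\mathcal R},\mu)$-unifier $\tau$ of $t$ and $s$ with degree $\mathfrak{d}_\tau\ge\mu$, then $\mathsf{HOPSU}$, started on $\{t\simeq^?_{{\mathcal R},\mu}s\};\varepsilon;1$, stops with a configuration $\emptyset;\sigma;\mathfrak{d}$ such that $\sigma\preceq^{\mathit{Dom}(\tau)}_{{\mathcal R},\mu}\tau$ and $\mathfrak{d}\ge\mathfrak{d}_\tau$.
   Context: Terms: simply typed $\lambda$-terms over disjoint countably infinite sets $\mathcal{V}$ (typed variables) and $\mathcal{F}$ (typed constants), types $\tau::=\delta\mid\tau\to\tau$. Terms are identified modulo $\alpha$, kept $\beta$-normal, and $\eta$-expanded except that arguments of free variables are kept $\eta$-normal (i.e. are bound variables); a term is written $\lambda x_1,\dots,x_n.h(t_1,\dots,t_m)$ with head $h$. Free variables are written $F,G,H,X,Y,\dots$, bound variables $x,y,z,\dots$. A higher-order pattern is a term where every free variable occurrence is applied to a list of pairwise distinct bound variables; all terms in problems and substitutions are higher-order patterns. Substitutions $\sigma$ are type-preserving maps with finite domain $\mathit{Dom}(\sigma)=\{X\mid X\sigma\neq X\}$, applied postfix ($t\sigma$, capture-avoiding, followed by $\beta$-normalization); $\sigma\vartheta$ means first $\sigma$ then $\vartheta$; $\varepsilon$ is the identity; $\varphi|_V$ is the restriction to $V$; $\mathtt{fv}(t)$ is the set of free variables. Fuzzy setting: T-norm $\wedge=\min$. ${\mathcal R}_A$ is a similarity relation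 (reflexive, symmetric, min-transitive map to $[0,1]$) on $\mathcal{F}\cup\mathcal{V}$ with ${\mathcal R}_A(x,y)=0$ for distinct variables, ${\mathcal R}_A(f,g)=0$ for constants of different types, ${\mathcal R}_A(x,f)=0$ for a variable and a constant. It induces ${\mathcal R}$ on terms: on normal forms ${\mathcal R}(a,b)={\mathcal R}_A(a,b)$ for symbols, ${\mathcal R}((t_1\,s_1),(t_2\,s_2))={\mathcal R}(t_1,t_2)\wedge{\mathcal R}(s_1,s_2)$, ${\mathcal R}(\lambda x.t,\lambda y.s)={\mathcal R}(t\{x\mapsto z\},s\{y\mapsto z\})$ for fresh $z$ of the same type, $0$ otherwise. A cut value is $\mu\in(0,1]$. Write $t\simeq_{{\mathcal R},\mu}s$ iff ${\mathcal R}(t,s)\ge\mu$. For a set of variables $V$, $\sigma\preceq^V_{{\mathcal R},\mu}\vartheta$ iff there is a substitution $\psi$ with $X\sigma\psi\simeq_{{\mathcal R},\mu}X\vartheta$ for all $X\in V$. An equation is written $t\simeq^?_{{\mathcal R},\mu}s$; a unification problem is a finite set of equations. A substitution $\sigma$ is an $({\mathcal R},\mu)$-unifier of $\{t_1\simeq^?_{{\mathcal R},\mu}s_1,\dots,t_n\simeq^?_{{\mathcal R},\mu}s_n\}$ with degree $\mathfrak{d}$ if ${\mathcal R}(t_1\sigma,s_1\sigma)\wedge\dots\wedge{\mathcal R}(t_n\sigma,s_n\sigma)=\mathfrak{d}\ge\mu$; a unifier of $t$ and $s$ is a unifier of $\{t\simeq^?_{{\mathcal R},\mu}s\}$. Algorithm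 $\mathsf{HOPSU}$: it works on configurations $P;\sigma;\mathfrak{d}$ ($P$ a problem, $\sigma$ a substitution, $\mathfrak{d}\ge\mu$ a degree) or $\bot$, applying the following rules to a selected equation as long as possible ($\uplus$ is disjoint union): (Abs) $\{\lambda x.t\simeq^?\lambda x.s\}\uplus P;\sigma;\mathfrak{d}\leadsto\{t\simeq^?s\}\cup P;\sigma;\mathfrak{d}$. (Dec) $\{f(t_1,\dots,t_n)\simeq^?g(s_1,\dots,s_n)\}\uplus P;\sigma;\mathfrak{d}\leadsto\{t_1\simeq^?s_1,\dots,t_n\simeq^?s_n\}\cup P;\sigma;\mathfrak{d}\wedge{\mathcal R}(f,g)$, where $f,g$ are rigid heads, $n\ge0$, and $\mathfrak{d}\wedge{\mathcal R}(f,g)\ge\mu$. (SV) $\{F(x_1,\dots,x_n)\simeq^?F(y_1,\dots,y_n)\}\uplus P;\sigma;\mathfrak{d}\leadsto P\vartheta;\sigma\vartheta;\mathfrak{d}$, where $\{z_1,\dots,z_m\}=\{x_i\mid x_i=y_i\}$ and $\vartheta=\{F\mapsto\lambda x_1,\dots,x_n.H(z_1,\dots,z_m)\}$ with $H$ fresh. (Ori) $\{a(s_1,\dots,s_m)\simeq^?F(x_1,\dots,x_n)\}\uplus P;\sigma;\mathfrak{d}\leadsto\{F(x_1,\dots,x_n)\simeq^?a(s_1,\dots,s_m)\}\cup P;\sigma;\mathfrak{d}$, where $F$ is free and $a$ is a constant or $a\in\{x_1,\dots,x_n\}$. (LF) $\{F(x_1,\dots,x_n)\simeq^?a(s_1,\dots,s_m)\}\uplus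 P;\sigma;\mathfrak{d}\leadsto P\vartheta;\sigma\vartheta;\mathfrak{d}$, where $F\notin\mathtt{fv}(a(s_1,\dots,s_m))$, $a$ is a constant, a free variable, or in $\{x_1,\dots,x_n\}$, $\mathsf{VarElim}(F(x_1,\dots,x_n),a(s_1,\dots,s_m))=\varphi$, and $\vartheta=\varphi|_V$ with $V=\{F\}\cup\mathtt{fv}(a(s_1,\dots,s_m))$. (Fail) $\{t\simeq^?s\}\uplus P;\sigma;\mathfrak{d}\leadsto\bot$ if no other rule applies to the selected equation. $\mathsf{VarElim}(t,s)$ starts from $\{t\simeq^?s\};\varepsilon$ and applies as long as possible: (VE1) $\{F(x_1,\dots,x_n)\simeq^?a(s_1,\dots,s_m)\}\uplus P;\sigma\leadsto\{H_1(x_1,\dots,x_n)\simeq^?s_1,\dots,H_m(x_1,\dots,x_n)\simeq^?s_m\}\cup P;\sigma\vartheta$, where $a$ is a constant or in $\{x_1,\dots,x_n\}$, $\vartheta=\{F\mapsto\lambda x_1,\dots,x_n.a(H_1(x_1,\dots,x_n),\dots,H_m(x_1,\dots,x_n))\}$ with $H_i$ fresh of appropriate types; (VE2) $\{F(x_1,\dots,x_n)\simeq^?G(y_1,\dots,y_m)\}\uplus P;\sigma\leadsto P\vartheta;\sigma\vartheta$, where $\{x_1,\dots,x_n\}\cap\{y_1,\dots,y_m\}=\{z_1,\dots,z_k\}$ and $\vartheta=\{F\mapsto\lambda x_1,\dots,x_n.H(z_1,\dots,z_k),G\mapsto\lambda y_1,\dots,y_m.H(z_1,\dots,z_k)\}$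 with $H$ fresh. If it ends in $\emptyset;\varphi$, then $\mathsf{VarElim}(t,s)=\varphi$.
   Formalization: VarElim gets an extra rule removing a common abstraction from both sides of an equation; without it VarElim is stuck on F ≃ f(λx.x), which is unifiable. Fresh variables are also required to avoid Dom(τ). *)

(* Defs.v *)
From Stdlib Require Import Reals List Arith Bool Relations.
Import ListNotations.

Inductive ty : Type :=
| Base (b : nat)
| Arr (A B : ty).

Definition ty_eq_dec : forall A B : ty, {A = B} + {A <> B}.
Proof. decide equality; apply Nat.eq_dec. Defined.

Definition fvar := (nat * ty)%type.
Definition cst := (nat * ty)%type.

Definition fvar_eq_dec : forall X Y : fvar, {X = Y} + {X <> Y}.
Proof. decide equality; [apply ty_eq_dec | apply Nat.eq_dec]. Defined.
Definition fvar_eqb (X Y : fvar) : bool := if fvar_eq_dec X Y then true else false.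

Fixpoint args_of (T : ty) : list ty :=
  match T with Base _ => [] | Arr A B => A :: args_of B end.
Fixpoint res_of (T : ty) : nat :=
  match T with Base b => b | Arr _ B => res_of B end.
Definition arrows (As : list ty) (T : ty) : ty := fold_right Arr T As.

(* Terms: higher-order patterns in beta-normal, eta-long form (except   *)
(* that arguments of free variables are bound variables).  Bound        *)
(* variables are de Bruijn indices (so alpha-equivalence is equality).  *)
(*   Lam A t       ==  \x:A. t                                          *)
(*   Rig h [t1..tm] == h(t1,...,tm), h a constant or a bound variable   *)
(*   Flex F [x1..xn] == F(x1,...,xn), F free, xi bound variables        *)
Inductive head : Type :=
| HC (c : cst)
| HB (i : nat).

Inductive tm : Type :=
| Lam (A : ty) (t : tm)
| Rig (h : head) (ts : list tm)
| Flex (X : fvar) (xs : list nat).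

(* Typing in a context of bound-variable types (innermost first).
   It enforces eta-longness (rigid terms are fully applied, of base
   type) and the pattern condition (pairwise distinct bound arguments). *)
Inductive has_type : list ty -> tm -> ty -> Prop :=
| T_Lam G A t B :
    has_type (A :: G) t B -> has_type G (Lam A t) (Arr A B)
| T_RigC G c ts :
    Forall2 (has_type G) ts (args_of (snd c)) ->
    has_type G (Rig (HC c) ts) (Base (res_of (snd c)))
| T_RigB G i A ts :
    nth_error G i = Some A ->
    Forall2 (has_type G) ts (args_of A) ->
    has_type G (Rig (HB i) ts) (Base (res_of A))
| T_Flex G X xs :
    NoDup xs ->
    Forall2 (fun x A => nth_error G x = Some A) xs (args_of (snd X)) ->
    has_type G (Flex X xs) (Base (res_of (snd X))).

Fixpoint occb (X : fvar) (t : tm) : bool :=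
  match t with
  | Lam _ u => occb X u
  | Rig _ ts => existsb (occb X) ts
  | Flex Y _ => fvar_eqb X Y
  end.

Definition lams (As : list ty) (b : tm) : tm := fold_right Lam b As.

(* eta-expanded form of H(x1,...,xn) (xs = de Bruijn indices of x1..xn):
   \y1..yk. H(x1,..,xn,y1,..,yk) where H has k further arguments. *)
Definition eta_app (H : fvar) (xs : list nat) : tm :=
  let rhos := skipn (length xs) (args_of (snd H)) in
  let m := length rhos in
  lams rhos (Flex H (map (fun j => j + m) xs ++ rev (seq 0 m))).

(* Substitutions: total maps from free variables to closed patterns;   *)
(* X is unchanged iff sigma X = etaX X (the eta-long form of X).       *)
Definition subst := fvar -> tm.
Definition etaX (X : fvar) : tm := eta_app X [].
Definition eps : subst := etaX.

Definition in_dom (sg : subst) (X : fvar) : Prop := sg X <> etaX X.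

Definition wf_subst (sg : subst) : Prop :=
  (forall X, has_type [] (sg X) (snd X)) /\
  (exists l : list fvar, forall X, ~ In X l -> sg X = etaX X).

Definition up (rho : nat -> nat) (j : nat) : nat :=
  match j with 0 => 0 | S j' => S (rho j') end.

Definition rn_head (rho : nat -> nat) (h : head) : head :=
  match h with HC c => HC c | HB i => HB (rho i) end.

Fixpoint rename (rho : nat -> nat) (t : tm) : tm :=
  match t with
  | Lam A u => Lam A (rename (up rho) u)
  | Rig h ts => Rig (rn_head rho h) (map (rename rho) ts)
  | Flex X xs => Flex X (map rho xs)
  end.

Fixpoint strip (n : nat) (u : tm) : tm :=
  match n, u with
  | S n', Lam _ b => strip n' b
  | _, _ => u
  end.

(* beta-normal form of (\z1..zn. body) x1 .. xn : a renaming *)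
Definition inst (u : tm) (xs : list nat) : tm :=
  let n := length xs in
  rename (fun j => if j <? n then nth (n - 1 - j) xs 0 else j - n) (strip n u).

(* t sigma (capture-avoiding, followed by beta-normalization) *)
Fixpoint sapp (sg : subst) (t : tm) : tm :=
  match t with
  | Lam A u => Lam A (sapp sg u)
  | Rig h ts => Rig h (map (sapp sg) ts)
  | Flex X xs => inst (sg X) xs
  end.

Definition compose (sg th : subst) : subst := fun X => sapp th (sg X).

Definition restrict (phi : subst) (V : fvar -> bool) : subst :=
  fun X => if V X then phi X else etaX X.

Definition upd (F : fvar) (u : tm) : subst :=
  fun X => if fvar_eq_dec X F then u else etaX X.
Definition upd2 (F : fvar) (u : tm) (G : fvar) (v : tm) : subst :=
  fun X => if fvar_eq_dec X F then u else if fvar_eq_dec X G then v else etaX X.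

Local Open Scope R_scope.

(* R_A restricted to constants; on variables R_A is forced by the
   context: R_A(x,x)=1, R_A(x,y)=0 for distinct variables,
   R_A(x,f)=0 for a variable and a constant. *)
Definition is_similarity (RA : cst -> cst -> R) : Prop :=
  (forall a b, 0 <= RA a b <= 1) /\
  (forall a, RA a a = 1) /\
  (forall a b, RA a b = RA b a) /\
  (forall a b c, Rmin (RA a b) (RA b c) <= RA a c) /\
  (forall a b, snd a <> snd b -> RA a b = 0).

Definition Rh (RA : cst -> cst -> R) (h g : head) : R :=
  match h, g with
  | HC c, HC d => RA c d
  | HB i, HB j => if Nat.eq_dec i j then 1 else 0
  | _, _ => 0
  end.

Fixpoint Rt (RA : cst -> cst -> R) (t s : tm) {struct t} : R :=
  match t, s with
  | Lam A t', Lam B s' => if ty_eq_dec A B then Rt RA t' s' else 0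
  | Rig h ts, Rig g ss =>
      Rmin (Rh RA h g)
        ((fix Rl (l1 l2 : list tm) {struct l1} : R :=
            match l1, l2 with
            | [], [] => 1
            | a :: l1', b :: l2' => Rmin (Rt RA a b) (Rl l1' l2')
            | _, _ => 0
            end) ts ss)
  | Flex X xs, Flex Y ys =>
      if fvar_eq_dec X Y then
        if list_eq_dec Nat.eq_dec xs ys then 1 else 0
      else 0
  | _, _ => 0
  end.

Definition more_general (RA : cst -> cst -> R) (mu : R) (V : fvar -> Prop)
  (sg th : subst) : Prop :=
  exists psi, wf_subst psi /\ forall X, V X -> Rt RA (sapp psi (sg X)) (th X) >= mu.

Definition eqn := (tm * tm)%type.
Definition eapp (sg : subst) (e : eqn) : eqn := (sapp sg (fst e), sapp sg (snd e)).

Definition used_eqs (P : list eqn) (X : fvar) : Prop :=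
  exists e, In e P /\ (occb X (fst e) = true \/ occb X (snd e) = true).
Definition used_sub (sg : subst) (X : fvar) : Prop :=
  in_dom sg X \/ exists Y, in_dom sg Y /\ occb X (sg Y) = true.
Definition used (U : fvar -> Prop) (P : list eqn) (sg : subst) (X : fvar) : Prop :=
  U X \/ used_eqs P X \/ used_sub sg X.

Local Open Scope nat_scope.

Definition sv_pos (xs ys : list nat) : list nat :=
  filter (fun k => Nat.eqb (nth k xs 0) (nth k ys 0)) (seq 0 (length xs)).
Definition ve2_pos (xs ys : list nat) : list nat :=
  filter (fun k => existsb (Nat.eqb (nth k xs 0)) ys) (seq 0 (length xs)).
Fixpoint index_of (j : nat) (l : list nat) : nat :=
  match l with [] => 0 | y :: l' => if Nat.eqb j y then 0 else S (index_of j l') end.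

(* the type of the fresh H in F |-> \x1..xn. H(x_k)_{k in pos} *)
Definition pos_type (F : fvar) (pos : list nat) : ty :=
  arrows (map (fun k => nth k (args_of (snd F)) (Base 0)) pos) (Base (res_of (snd F))).

(* SV: F |-> \x1..xn. H(z1..zm) *)
Definition sv_binding (F : fvar) (xs ys : list nat) (H : fvar) : tm :=
  lams (args_of (snd F))
    (Flex H (map (fun k => length xs - 1 - k) (sv_pos xs ys))).

Definition ve2_bindingF (F : fvar) (xs ys : list nat) (H : fvar) : tm :=
  lams (args_of (snd F))
    (Flex H (map (fun k => length xs - 1 - k) (ve2_pos xs ys))).
Definition ve2_bindingG (G : fvar) (xs ys : list nat) (H : fvar) : tm :=
  lams (args_of (snd G))
    (Flex H (map (fun k => length ys - 1 - index_of (nth k xs 0) ys) (ve2_pos xs ys))).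

(* rigid head a of an equation F(x1..xn) ~ a(...): a constant or some x_k;
   a' is a as seen inside the binding \x1..xn. _ ; Ta is the type of a *)
Inductive rigid_in (xs : list nat) (Fargs : list ty) : head -> head -> ty -> Prop :=
| RI_C c : rigid_in xs Fargs (HC c) (HC c) (snd c)
| RI_B k j A : nth_error xs k = Some j -> nth_error Fargs k = Some A ->
    rigid_in xs Fargs (HB j) (HB (length xs - 1 - k)) A.

(* VE1: F |-> \x1..xn. a(H1(x1..xn),...,Hm(x1..xn)) (eta-expanded) *)
Definition ve1_binding (F : fvar) (xs : list nat) (a' : head) (Hs : list fvar) : tm :=
  lams (args_of (snd F))
    (Rig a' (map (fun H => eta_app H (rev (seq 0 (length xs)))) Hs)).

Inductive ve_step (U : fvar -> Prop) : list eqn * subst -> list eqn * subst -> Prop :=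
| VE_Abs P1 P2 A t s phi :
    ve_step U (P1 ++ (Lam A t, Lam A s) :: P2, phi) ((t, s) :: P1 ++ P2, phi)
| VE_1 P1 P2 F xs a ss phi a' Ta Hs :
    rigid_in xs (args_of (snd F)) a a' Ta ->
    length Hs = length ss ->
    NoDup Hs ->
    Forall (fun H => ~ used U (P1 ++ (Flex F xs, Rig a ss) :: P2) phi H) Hs ->
    Forall2 (fun H rho => snd H = arrows (args_of (snd F)) rho) Hs (args_of Ta) ->
    ve_step U (P1 ++ (Flex F xs, Rig a ss) :: P2, phi)
      (combine (map (fun H => eta_app H xs) Hs) ss ++ P1 ++ P2,
       compose phi (upd F (ve1_binding F xs a' Hs)))
| VE_2 P1 P2 F xs G ys H phi :
    F <> G ->
    ~ used U (P1 ++ (Flex F xs, Flex G ys) :: P2) phi H ->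
    snd H = pos_type F (ve2_pos xs ys) ->
    ve_step U (P1 ++ (Flex F xs, Flex G ys) :: P2, phi)
      (map (eapp (upd2 F (ve2_bindingF F xs ys H) G (ve2_bindingG G xs ys H))) (P1 ++ P2),
       compose phi (upd2 F (ve2_bindingF F xs ys H) G (ve2_bindingG G xs ys H))).

Definition VarElim (U : fvar -> Prop) (t s : tm) (phi : subst) : Prop :=
  clos_refl_trans_1n _ (ve_step U) ([(t, s)], eps) ([], phi).

(* None = bottom *)
Definition config := option (list eqn * subst * R).

Definition rigid_ok (xs : list nat) (a : head) : Prop :=
  match a with HC _ => True | HB j => In j xs end.
Definition lf_ok (xs : list nat) (u : tm) : Prop :=
  match u with Rig a _ => rigid_ok xs a | Flex _ _ => True | Lam _ _ => False end.

Definition lf_sub (F : fvar) (u : tm) (phi : subst) : subst :=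
  restrict phi (fun X => fvar_eqb X F || occb X u).

Local Open Scope R_scope.

(* the non-Fail rules applied to the selected equation e of
   P1 ++ e :: P2 ; sg ; d.  Fresh variables avoid the list [avoid]
   and every variable of the current configuration. *)
Inductive rule (RA : cst -> cst -> R) (mu : R) (avoid : list fvar)
  (P1 : list eqn) (e : eqn) (P2 : list eqn) (sg : subst) (d : R) : config -> Prop :=
| R_Abs A t s :
    e = (Lam A t, Lam A s) ->
    rule RA mu avoid P1 e P2 sg d (Some ((t, s) :: P1 ++ P2, sg, d))
| R_Dec f g ts ss :
    e = (Rig f ts, Rig g ss) ->
    length ts = length ss ->
    Rmin d (Rh RA f g) >= mu ->
    rule RA mu avoid P1 e P2 sg d (Some (combine ts ss ++ P1 ++ P2, sg, Rmin d (Rh RA f g)))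
| R_SV F xs ys H :
    e = (Flex F xs, Flex F ys) ->
    length xs = length ys ->
    ~ used (fun X => In X avoid) (P1 ++ e :: P2) sg H ->
    snd H = pos_type F (sv_pos xs ys) ->
    rule RA mu avoid P1 e P2 sg d
      (Some (map (eapp (upd F (sv_binding F xs ys H))) (P1 ++ P2),
             compose sg (upd F (sv_binding F xs ys H)), d))
| R_Ori a ss F xs :
    e = (Rig a ss, Flex F xs) ->
    rigid_ok xs a ->
    rule RA mu avoid P1 e P2 sg d (Some ((Flex F xs, Rig a ss) :: P1 ++ P2, sg, d))
| R_LF F xs u phi :
    e = (Flex F xs, u) ->
    lf_ok xs u ->
    occb F u = false ->
    VarElim (used (fun X => In X avoid) (P1 ++ e :: P2) sg) (Flex F xs) u phi ->
    rule RA mu avoid P1 e P2 sg d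
      (Some (map (eapp (lf_sub F u phi)) (P1 ++ P2), compose sg (lf_sub F u phi), d)).

Inductive step (RA : cst -> cst -> R) (mu : R) (avoid : list fvar) : config -> config -> Prop :=
| S_rule P1 e P2 sg d c :
    rule RA mu avoid P1 e P2 sg d c ->
    step RA mu avoid (Some (P1 ++ e :: P2, sg, d)) c
| S_Fail P1 e P2 sg d :
    (forall c, ~ rule RA mu avoid P1 e P2 sg d c) ->
    step RA mu avoid (Some (P1 ++ e :: P2, sg, d)) None.

Definition init_config (t s : tm) : config := Some ([(t, s)], eps, 1).

(* Main.v *)
From Stdlib Require Import Reals List Arith Bool Relations Lia Lra Classical.
Require Import Defs.
Import ListNotations.

(* Cut the similarity at the degree [D] of [tau]: "similarity at least [D]" is then an
   equivalence on terms, relaxing only the equality of constants.  Throughout a run there is a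
   substitution [psi], equal to [tau] at the start, that solves the current problem up to this
   equivalence and satisfies [X sg psi ~ X tau] for all [X] in [avoid]; each rule with binding
   [th] is answered by a new [psi'] with [Y th psi' ~ Y psi] on all non-fresh [Y].  The existence
   of [psi] keeps the degree at least [D] and excludes failure.  It also gives termination,
   because every rule but Ori decreases the total size of the problem instantiated by its
   solution.  VarElim is treated by the same invariant and measure. *)

(** Why the cut is made at [D] and not at [mu]: a solution at degree [D] passes every guard [>= mu],
    and the same threshold bounds the computed degree from below, so no degree has to be traced
    through the bindings. Positivity of [D] makes bound variables similar only to themselves and
    similar constants equally typed.

    The answer [psi'] can match [psi] only up to similarity: imitation copies the head of the
    equation, whereas the instance of [F] may carry another constant similar to it. The measure
    survives because similar terms have equal size.

    Dropping arguments is harmless because bound variables are rigid: in two similar instances they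
    stand at the same places, so the body of [psi F] cannot depend on an argument that the binding
    omits.

    LF keeps only a restriction of what VarElim computes, so VarElim also records that, among the
    old variables, it moves only those of its starting equation. VarElim has no rule for a variable
    equated with itself or for a rigid left-hand side; a separate shape invariant shows that neither
    arises. *)

(** * Induction on terms and pointwise relations on lists *)

Lemma tm_nested_ind (P : tm -> Prop) :
  (forall A t, P t -> P (Lam A t)) ->
  (forall h ts, Forall P ts -> P (Rig h ts)) ->
  (forall X xs, P (Flex X xs)) ->
  forall t, P t.
Proof.
  intros HL HR HF. fix IH 1. intros [A t|h ts|X xs].
  - apply HL, IH.
  - apply HR. induction ts as [|u us IHus]; constructor; [apply IH | apply IHus].
  - apply HF.
Qed.

Lemma Forall_map_ext {A B} (f g : A -> B) l :
  Forall (fun x => f x = g x) l -> map f l = map g l.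
Proof. induction 1; simpl; congruence. Qed.

Lemma Forall2_mono {A B} (P Q : A -> B -> Prop) l l' :
  (forall a b, In a l -> P a b -> Q a b) -> Forall2 P l l' -> Forall2 Q l l'.
Proof.
  intros H F. induction F; constructor; auto.
  - apply H; simpl; auto.
  - apply IHF. intros; apply H; simpl; auto.
Qed.

Lemma Forall2_map_l {A A' B} (P : A' -> B -> Prop) (f : A -> A') l l' :
  Forall2 (fun a b => P (f a) b) l l' -> Forall2 P (map f l) l'.
Proof. induction 1; simpl; constructor; auto. Qed.

Lemma Forall2_lookup {A B} (P : A -> B -> Prop) l l' :
  Forall2 P l l' ->
  forall k b, nth_error l' k = Some b -> exists a, nth_error l k = Some a /\ P a b.
Proof.
  induction 1 as [|a b l l' Hab _ IH]; intros [|k] b'; simpl; try discriminate.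
  - intros [= <-]; eauto.
  - apply IH.
Qed.

Lemma Forall2_join {A B C} (P : A -> C -> Prop) (Q : B -> C -> Prop) l l' l'' :
  Forall2 P l l'' -> Forall2 Q l' l'' ->
  Forall2 (fun a b => exists c, P a c /\ Q b c) l l'.
Proof.
  intros F. revert l'. induction F; inversion 1; subst; constructor; eauto.
Qed.

Lemma Forall2_map_same {A B C} (P : B -> C -> Prop) (f : A -> B) (g : A -> C) l :
  Forall (fun a => P (f a) (g a)) l -> Forall2 P (map f l) (map g l).
Proof. induction 1; simpl; constructor; auto. Qed.

Lemma Forall2_maps {A B C E} (P : A -> B -> Prop) (f : C -> A) (g : E -> B) l l' :
  Forall2 (fun c e => P (f c) (g e)) l l' <-> Forall2 P (map f l) (map g l').
Proof.
  split.
  - induction 1; simpl; constructor; auto.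
  - revert l'. induction l as [|c l IH]; intros [|e l']; simpl; inversion 1; subst; auto.
Qed.

Lemma fvar_eqb_spec X Y : fvar_eqb X Y = true <-> X = Y.
Proof. unfold fvar_eqb. destruct (fvar_eq_dec X Y); split; congruence. Qed.

(** * Types and abstractions *)

Lemma arrows_args T : arrows (args_of T) (Base (res_of T)) = T.
Proof. induction T; simpl; congruence. Qed.

Lemma args_of_arrows As T : args_of (arrows As T) = As ++ args_of T.
Proof. induction As; simpl; congruence. Qed.

Lemma res_of_arrows As T : res_of (arrows As T) = res_of T.
Proof. induction As; simpl; congruence. Qed.

Lemma has_type_lams As G b T :
  has_type (rev As ++ G) b T -> has_type G (lams As b) (arrows As T).
Proof.
  revert G. induction As as [|A As IH]; intros G Hb; simpl in *; auto.
  constructor. apply IH. now rewrite <- app_assoc in Hb.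
Qed.

Lemma has_type_lams_inv T G t :
  has_type G t T ->
  exists b, t = lams (args_of T) b /\ has_type (rev (args_of T) ++ G) b (Base (res_of T)).
Proof.
  revert G t. induction T as [c|A _ B IH]; intros G t Ht; simpl.
  - exists t; auto.
  - inversion Ht; subst. destruct (IH _ _ H2) as (b & -> & Hb).
    exists b. split; auto. now rewrite <- app_assoc.
Qed.

(** Arrow types are inhabited by abstractions only, [Rig] and [Flex] being typed at base types.
    Every value of a substitution is thus a full abstraction over a body of base type, and
    instantiating it amounts to renaming that body. *)
Lemma closed_lams T u :
  has_type [] u T ->
  exists b, u = lams (args_of T) b /\ has_type (rev (args_of T)) b (Base (res_of T)).
Proof.
  intros H. apply has_type_lams_inv in H as (b & -> & Hb). rewrite app_nil_r in Hb. eauto.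
Qed.

Lemma strip_lams As b : strip (length As) (lams As b) = b.
Proof. induction As; simpl; auto. Qed.

Lemma sapp_lams sg As b : sapp sg (lams As b) = lams As (sapp sg b).
Proof. induction As; simpl; congruence. Qed.

Lemma occb_lams X As b : occb X (lams As b) = occb X b.
Proof. induction As; simpl; congruence. Qed.

Definition head_type (G : list ty) (h : head) (A : ty) : Prop :=
  match h with HC c => A = snd c | HB i => nth_error G i = Some A end.

Lemma has_type_Lam_inv G A t T :
  has_type G (Lam A t) T -> exists B, T = Arr A B /\ has_type (A :: G) t B.
Proof. intros H. inversion H; subst. eauto. Qed.

Lemma has_type_Rig G h A ts :
  head_type G h A -> Forall2 (has_type G) ts (args_of A) ->
  has_type G (Rig h ts) (Base (res_of A)).
Proof. destruct h; simpl; intros Hh F; [subst|]; econstructor; eauto. Qed.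

Lemma has_type_Rig_inv G h ts T :
  has_type G (Rig h ts) T ->
  exists A, head_type G h A /\ T = Base (res_of A) /\ Forall2 (has_type G) ts (args_of A).
Proof. intros H. inversion H; subst; eexists; split; simpl; eauto. Qed.

Lemma has_type_Flex_inv G X xs T :
  has_type G (Flex X xs) T ->
  T = Base (res_of (snd X)) /\ NoDup xs /\
  Forall2 (fun x A => nth_error G x = Some A) xs (args_of (snd X)).
Proof. intros H. inversion H; subst. auto. Qed.

Lemma rig_arg_typed G h ts T u :
  has_type G (Rig h ts) T -> In u ts -> exists B, has_type G u B.
Proof.
  intros Ht Hu. apply In_nth_error in Hu as [k Hk].
  apply has_type_Rig_inv in Ht as (A & _ & _ & F). apply Forall2_flip in F.
  destruct (Forall2_lookup _ _ _ F _ _ Hk) as (B & _ & HB); eauto.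
Qed.

(** * Renaming of bound variables *)

(** The renaming behind [inst] is injective and type-preserving only on the binders that it
    instantiates, so conditions on renamings are imposed only at the indices that occur free. *)
Inductive bfree : nat -> tm -> Prop :=
| bf_lam i A t : bfree (S i) t -> bfree i (Lam A t)
| bf_head i ts : bfree i (Rig (HB i) ts)
| bf_arg i h t ts : In t ts -> bfree i t -> bfree i (Rig h ts)
| bf_flex i X xs : In i xs -> bfree i (Flex X xs).
#[local] Hint Constructors bfree : core.

Lemma rename_ext t : forall r1 r2,
  (forall i, bfree i t -> r1 i = r2 i) -> rename r1 t = rename r2 t.
Proof.
  induction t as [A t IH|h ts IH|X xs] using tm_nested_ind; intros r1 r2 H; simpl; f_equal.
  - apply IH. intros [|i] Hi; simpl; auto.
  - destruct h; simpl; f_equal; auto.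
  - apply Forall_map_ext. rewrite Forall_forall in *. intros u Hu. apply IH; eauto.
  - apply map_ext_in. intros; apply H; auto.
Qed.

Lemma rename_rename t : forall r1 r2,
  rename r1 (rename r2 t) = rename (fun i => r1 (r2 i)) t.
Proof.
  induction t as [A t IH|h ts IH|X xs] using tm_nested_ind; intros r1 r2; simpl; f_equal.
  - rewrite IH. apply rename_ext. intros [|i] _; auto.
  - destruct h; auto.
  - rewrite map_map. apply Forall_map_ext. rewrite Forall_forall in *. auto.
  - apply map_map.
Qed.

Lemma rename_id t : forall r, (forall i, bfree i t -> r i = i) -> rename r t = t.
Proof.
  induction t as [A t IH|h ts IH|X xs] using tm_nested_ind; intros r H; simpl; f_equal.
  - apply IH. intros [|i] Hi; simpl; auto.
  - destruct h; simpl; f_equal; auto.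
  - rewrite <- (map_id ts) at 2. apply Forall_map_ext. rewrite Forall_forall in *. intros u Hu.
    apply IH; eauto.
  - rewrite <- (map_id xs) at 2. apply map_ext_in. intros; apply H; auto.
Qed.

Lemma occb_rename X t : forall r, occb X (rename r t) = occb X t.
Proof.
  induction t as [A t IH|h ts IH|Y xs] using tm_nested_ind; intros r; simpl; auto.
  induction IH; simpl; congruence.
Qed.

(** The renaming under the abstractions is the iterate of [up], once per binder, in closed form. *)
Lemma rename_lams As t : forall r,
  rename r (lams As t) =
  lams As (rename (fun j => if j <? length As then j else r (j - length As) + length As) t).
Proof.
  induction As as [|A As IH]; intros r; simpl.
  - apply rename_ext. intros i _. rewrite Nat.sub_0_r. lia.
  - f_equal. rewrite IH. f_equal. apply rename_ext. intros i _.
    destruct (Nat.ltb_spec i (length As)), (Nat.ltb_spec i (S (length As))); try lia.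
    + replace (i - length As) with 0 by lia. simpl. lia.
    + replace (i - length As) with (S (i - S (length As))) by lia. simpl. lia.
Qed.

Lemma bfree_typed t : forall G T i, has_type G t T -> bfree i t -> i < length G.
Proof.
  induction t as [A t IH|h ts IH|X xs] using tm_nested_ind; intros G T i Ht Hi.
  - apply has_type_Lam_inv in Ht as (B & -> & Ht). inversion Hi; subst.
    eapply IH in Ht; eauto. simpl in Ht; lia.
  - inversion Hi as [|? ? E|? ? u ? Hu Hiu|]; subst.
    + apply has_type_Rig_inv in Ht as (A & HA & _ & _). apply nth_error_Some.
      simpl in HA; congruence.
    + rewrite Forall_forall in IH. destruct (rig_arg_typed _ _ _ _ _ Ht Hu). eauto.
  - apply has_type_Flex_inv in Ht as (_ & _ & F). inversion Hi as [| | |? ? ? Hx]; subst.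
    apply In_nth_error in Hx as [k Hk]. apply Forall2_flip in F.
    destruct (Forall2_lookup _ _ _ F _ _ Hk) as (A & _ & HA).
    apply nth_error_Some; simpl in HA; congruence.
Qed.

(** Injectivity on the free indices is what preserves the pattern condition: the arguments of a
    flexible term must remain pairwise distinct. *)
Lemma rename_typed t : forall r G G' T,
  has_type G t T ->
  (forall i A, bfree i t -> nth_error G i = Some A -> nth_error G' (r i) = Some A) ->
  (forall i j, bfree i t -> bfree j t -> r i = r j -> i = j) ->
  has_type G' (rename r t) T.
Proof.
  induction t as [A t IH|h ts IH|X xs] using tm_nested_ind; intros r G G' T Ht Hr Hinj; simpl.
  - apply has_type_Lam_inv in Ht as (B & -> & Ht). constructor. eapply IH; eauto.
    + intros [|i] C Hi; simpl; auto.
    + intros [|i] [|j] Hi Hj; simpl; auto; discriminate.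
  - apply has_type_Rig_inv in Ht as (A & HA & -> & F). apply has_type_Rig.
    + destruct h; simpl in *; auto.
    + apply Forall2_map_l. revert F. apply Forall2_mono. rewrite Forall_forall in IH.
      intros u B Hu HB. eapply IH; eauto.
  - apply has_type_Flex_inv in Ht as (-> & N & F). constructor.
    + apply NoDup_map_NoDup_ForallPairs; auto. intros x y Hx Hy. apply Hinj; auto.
    + apply Forall2_map_l. revert F. apply Forall2_mono. eauto.
Qed.

(** * Substitution *)

(** The renaming inside [inst]. De Bruijn indices count from the innermost binder while [xs] lists
    arguments for the outermost first, hence the reversal [length xs - 1 - j]. *)
Definition ins (xs : list nat) (j : nat) : nat :=
  if j <? length xs then nth (length xs - 1 - j) xs 0 else j - length xs.

Lemma inst_lams As b xs :
  length xs = length As -> inst (lams As b) xs = rename (ins xs) b.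
Proof. intros H. unfold inst. rewrite H, strip_lams, <- H. reflexivity. Qed.

Lemma nth_error_rev_sub {A} (l : list A) i :
  i < length l -> nth_error (rev l) i = nth_error l (length l - 1 - i).
Proof.
  intros H. rewrite nth_error_rev. destruct (Nat.ltb_spec i (length l)); [|lia].
  f_equal. lia.
Qed.

Lemma ins_lookup (G : list ty) xs As i A :
  Forall2 (fun x B => nth_error G x = Some B) xs As ->
  nth_error (rev As) i = Some A -> nth_error G (ins xs i) = Some A.
Proof.
  intros F H. assert (Hi : i < length As).
  { rewrite <- length_rev. apply nth_error_Some. congruence. }
  rewrite nth_error_rev_sub in H by auto. pose proof (Forall2_length F) as E.
  destruct (Forall2_lookup _ _ _ F _ _ H) as (x & Hx & HG).
  unfold ins. rewrite E. destruct (Nat.ltb_spec i (length As)); [|lia].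
  erewrite nth_error_nth; eauto.
Qed.

Lemma ins_inj xs i j :
  NoDup xs -> i < length xs -> j < length xs -> ins xs i = ins xs j -> i = j.
Proof.
  intros N Hi Hj. unfold ins.
  destruct (Nat.ltb_spec i (length xs)), (Nat.ltb_spec j (length xs)); try lia.
  intros E. rewrite NoDup_nth in N. apply N in E; lia.
Qed.

(** [rev (seq 0 n)] lists the indices of [n] binders from the outermost inwards, as in an
    eta-expansion; so this is the beta step that makes [etaX] act as the identity. *)
Lemma map_ins_rev_seq xs : map (ins xs) (rev (seq 0 (length xs))) = xs.
Proof.
  apply nth_ext with (d := ins xs 0) (d' := 0).
  - now rewrite length_map, length_rev, length_seq.
  - rewrite length_map, length_rev, length_seq. intros i Hi.
    rewrite map_nth, rev_nth by (rewrite length_seq; lia).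
    rewrite length_seq, seq_nth by lia. unfold ins.
    destruct (Nat.ltb_spec (0 + (length xs - S i)) (length xs)); [|lia]. f_equal; lia.
Qed.

Definition typed_subst (sg : subst) : Prop := forall X, has_type [] (sg X) (snd X).

Lemma inst_typed G u T xs :
  has_type [] u T -> NoDup xs ->
  Forall2 (fun x A => nth_error G x = Some A) xs (args_of T) ->
  has_type G (inst u xs) (Base (res_of T)).
Proof.
  intros Hu N F. apply closed_lams in Hu as (b & -> & Hb).
  pose proof (Forall2_length F) as E. rewrite inst_lams by auto.
  eapply rename_typed; eauto.
  - intros i A _. now apply ins_lookup.
  - intros i j Hi Hj. apply ins_inj; auto.
    + eapply bfree_typed in Hi; eauto. rewrite length_rev in Hi. lia.
    + eapply bfree_typed in Hj; eauto. rewrite length_rev in Hj. lia.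
Qed.

Lemma sapp_typed sg t : forall G T,
  typed_subst sg -> has_type G t T -> has_type G (sapp sg t) T.
Proof.
  induction t as [A t IH|h ts IH|X xs] using tm_nested_ind; intros G T Hsg Ht; simpl.
  - apply has_type_Lam_inv in Ht as (B & -> & Ht). constructor; auto.
  - apply has_type_Rig_inv in Ht as (A & HA & -> & F). apply has_type_Rig; auto.
    apply Forall2_map_l. revert F. apply Forall2_mono. rewrite Forall_forall in IH. auto.
  - apply has_type_Flex_inv in Ht as (-> & N & F). now apply inst_typed.
Qed.

(** Beyond the arguments [ins] only shifts, which need not commute with [r]; but [u] is closed, so
    every index free in its body points to an argument. *)
Lemma inst_rename G u T xs r :
  has_type [] u T -> Forall2 (fun x A => nth_error G x = Some A) xs (args_of T) ->
  inst u (map r xs) = rename r (inst u xs).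
Proof.
  intros Hu F. apply closed_lams in Hu as (b & -> & Hb).
  pose proof (Forall2_length F) as E.
  rewrite !inst_lams by (rewrite ?length_map; auto). rewrite rename_rename.
  apply rename_ext. intros i Hi. eapply bfree_typed in Hi; eauto. rewrite length_rev in Hi.
  unfold ins. rewrite length_map. destruct (Nat.ltb_spec i (length xs)); [|lia].
  rewrite nth_indep with (d' := r 0) by (rewrite length_map; lia). apply map_nth.
Qed.

Lemma sapp_rename sg t : forall G T r,
  typed_subst sg -> has_type G t T -> sapp sg (rename r t) = rename r (sapp sg t).
Proof.
  induction t as [A t IH|h ts IH|X xs] using tm_nested_ind; intros G T r Hsg Ht; simpl.
  - apply has_type_Lam_inv in Ht as (B & -> & Ht). f_equal; eauto.
  - f_equal. rewrite !map_map. apply map_ext_in. intros u Hu. rewrite Forall_forall in IH.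
    destruct (rig_arg_typed _ _ _ _ _ Ht Hu) as [B HB].
    eauto.
  - apply has_type_Flex_inv in Ht as (-> & N & F). eapply inst_rename; eauto.
Qed.

(** At a flexible term, [inst] is a renaming of the body of [sg X], so the composition law reduces
    to the commutation of substitution with renaming. *)
Lemma sapp_sapp sg th t : forall G T,
  typed_subst sg -> typed_subst th -> has_type G t T ->
  sapp th (sapp sg t) = sapp (compose sg th) t.
Proof.
  induction t as [A t IH|h ts IH|X xs] using tm_nested_ind; intros G T Hsg Hth Ht; simpl.
  - apply has_type_Lam_inv in Ht as (B & -> & Ht). f_equal; eauto.
  - f_equal. rewrite !map_map. apply map_ext_in. intros u Hu. rewrite Forall_forall in IH.
    destruct (rig_arg_typed _ _ _ _ _ Ht Hu) as [B HB].
    eauto.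
  - apply has_type_Flex_inv in Ht as (-> & N & F). pose proof (Forall2_length F) as E.
    destruct (closed_lams _ _ (Hsg X)) as (b & Eb & Hb).
    unfold compose. rewrite Eb, sapp_lams, !inst_lams by auto.
    eapply sapp_rename; eauto.
Qed.

Lemma rev_seq_lookup {A} (G l : list A) :
  Forall2 (fun x B => nth_error (rev l ++ G) x = Some B) (rev (seq 0 (length l))) l.
Proof.
  revert G. induction l as [|a l IH]; intros G; [constructor|].
  cbn [length]. rewrite seq_S, rev_app_distr. simpl. rewrite <- app_assoc. constructor; auto.
  rewrite nth_error_app2; rewrite length_rev; auto. now rewrite Nat.sub_diag.
Qed.

Lemma eta_app_typed H xs As T G :
  snd H = arrows As T -> NoDup xs ->
  Forall2 (fun x A => nth_error G x = Some A) xs As ->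
  has_type G (eta_app H xs) T.
Proof.
  intros E N F. pose proof (Forall2_length F) as L. unfold eta_app.
  rewrite E, args_of_arrows, L, skipn_app, Nat.sub_diag, skipn_all. simpl.
  refine (eq_ind _ (has_type G _) _ _ (arrows_args T)). apply has_type_lams.
  replace (res_of T) with (res_of (snd H)) by now rewrite E, res_of_arrows.
  set (m := length (args_of T)). constructor.
  - apply NoDup_app.
    + apply NoDup_map_NoDup_ForallPairs; auto. intros x y _ _; lia.
    + apply NoDup_rev, seq_NoDup.
    + intros a Ha Hb. rewrite <- in_rev, in_seq in Hb. apply in_map_iff in Ha as (x & <- & _). lia.
  - rewrite E, args_of_arrows. apply Forall2_app.
    + apply Forall2_map_l. revert F. apply Forall2_mono. intros x A _ HA.
      rewrite nth_error_app2; rewrite length_rev; fold m; [|lia].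
      rewrite <- HA. f_equal. lia.
    + apply rev_seq_lookup.
Qed.

(** The abstractions that [eta_app] adds for the residual arguments coincide with those at the top
    of [b], which is eta-long at the residual type [T]; only the instantiation by [xs] remains. *)
Lemma sapp_eta_app sg H xs As T b :
  snd H = arrows As T -> length xs = length As ->
  sg H = lams As b -> has_type (rev As) b T ->
  sapp sg (eta_app H xs) = rename (ins xs) b.
Proof.
  intros E L Es Hb. unfold eta_app.
  rewrite E, args_of_arrows, L, skipn_app, Nat.sub_diag, skipn_all. simpl.
  apply has_type_lams_inv in Hb as (c & -> & Hc).
  rewrite rename_lams, sapp_lams. f_equal. simpl. rewrite Es.
  replace (lams As (lams (args_of T) c)) with (lams (As ++ args_of T) c)
    by (unfold lams; now rewrite fold_right_app).
  set (m := length (args_of T)).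
  rewrite inst_lams by (rewrite !length_app, length_map, length_rev, length_seq; lia).
  apply rename_ext. intros i Hi. eapply bfree_typed in Hi; eauto.
  rewrite length_app, !length_rev in Hi. fold m in Hi. unfold ins.
  rewrite length_app, length_map, length_rev, length_seq.
  destruct (Nat.ltb_spec i (length xs + m)); [|lia].
  (* Indices below [m] are the residual binders; the others select arguments from [xs], shifted past
     these binders. *)
  destruct (Nat.ltb_spec i m).
  - rewrite app_nth2; rewrite length_map; [|lia].
    rewrite rev_nth; rewrite length_seq; [|lia]. rewrite seq_nth by lia. lia.
  - rewrite app_nth1 by (rewrite length_map; lia).
    destruct (Nat.ltb_spec (i - m) (length xs)); [|lia].
    rewrite nth_indep with (d' := 0 + m) by (rewrite length_map; lia).
    rewrite (map_nth (fun j => j + m)). do 2 f_equal. lia.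
Qed.

Lemma etaX_typed X : has_type [] (etaX X) (snd X).
Proof. apply eta_app_typed with (As := []); auto using NoDup_nil. Qed.

Lemma etaX_lams X :
  etaX X = lams (args_of (snd X)) (Flex X (rev (seq 0 (length (args_of (snd X)))))).
Proof. reflexivity. Qed.

Lemma sapp_etaX sg X : typed_subst sg -> sapp sg (etaX X) = sg X.
Proof.
  intros H. unfold etaX. rewrite sapp_eta_app with (As := []) (T := snd X) (b := sg X); auto.
  apply rename_id. intros i _. unfold ins; simpl. lia.
Qed.

Lemma inst_etaX X xs :
  length xs = length (args_of (snd X)) -> inst (etaX X) xs = Flex X xs.
Proof.
  intros L. rewrite etaX_lams, inst_lams by auto. simpl. f_equal. rewrite <- L.
  apply map_ins_rev_seq.
Qed.

Lemma occb_eta_app Y X xs : occb Y (eta_app X xs) = fvar_eqb Y X.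
Proof. unfold eta_app. now rewrite occb_lams. Qed.

Lemma sapp_ext t : forall th1 th2,
  (forall X, occb X t = true -> th1 X = th2 X) -> sapp th1 t = sapp th2 t.
Proof.
  induction t as [A t IH|h ts IH|X xs] using tm_nested_ind; intros th1 th2 H; simpl in *.
  - f_equal; auto.
  - f_equal. apply map_ext_in. intros u Hu. rewrite Forall_forall in IH. apply IH; auto.
    intros X HX. apply H. apply existsb_exists; eauto.
  - rewrite H; auto. now apply fvar_eqb_spec.
Qed.

Lemma occb_strip X n : forall u, occb X (strip n u) = occb X u.
Proof. induction n as [|n IH]; intros [| |]; simpl; auto. Qed.

Lemma occb_sapp Y th t :
  occb Y (sapp th t) = true -> exists Z, occb Z t = true /\ occb Y (th Z) = true.
Proof.
  induction t as [A t IH|h ts IH|X xs] using tm_nested_ind; simpl; intros H.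
  - auto.
  - apply existsb_exists in H as (u' & Hu' & HY). apply in_map_iff in Hu' as (u & <- & Hu).
    rewrite Forall_forall in IH. destruct (IH u Hu HY) as (Z & HZ & HYZ).
    exists Z. split; auto. apply existsb_exists; eauto.
  - exists X. split; [now apply fvar_eqb_spec|].
    unfold inst in H. now rewrite occb_rename, occb_strip in H.
Qed.

(** * Size of terms *)

(** A flexible term counts 1 whatever its arguments, and a rigid head counts 1 whatever its symbol,
    so neither renaming nor the exchange of similar constants changes the size. *)
Fixpoint size (t : tm) : nat :=
  match t with
  | Lam _ u => S (size u)
  | Rig _ ts => S (list_sum (map size ts))
  | Flex _ _ => 1
  end.

Lemma size_pos t : 0 < size t.
Proof. destruct t; simpl; lia. Qed.

Lemma size_rename t : forall r, size (rename r t) = size t.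
Proof.
  induction t as [A t IH|h ts IH|X xs] using tm_nested_ind; intros r; simpl; auto.
  f_equal. induction IH; simpl; auto.
Qed.

(** The instance of [t] contains a renamed copy of the body of [psi F]. This is the source of the
    occurs check: [F] cannot be similar to a rigid term that contains it. *)
Lemma size_sapp_occb psi F t : forall G T,
  has_type G t T -> occb F t = true ->
  size (strip (length (args_of (snd F))) (psi F)) <= size (sapp psi t).
Proof.
  induction t as [A t IH|h ts IH|X xs] using tm_nested_ind; intros G T Ht HF; simpl in *.
  - apply has_type_Lam_inv in Ht as (B & -> & Ht). specialize (IH _ _ Ht HF). lia.
  - apply existsb_exists in HF as (u & Hu & HF). rewrite Forall_forall in IH.
    apply in_split in Hu as Hs. destruct Hs as (l1 & l2 & E).
    destruct (rig_arg_typed _ _ _ _ _ Ht Hu) as [B HB].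
    specialize (IH u Hu _ _ HB HF). rewrite E, !map_app, list_sum_app. simpl. lia.
  - apply fvar_eqb_spec in HF as <-. apply has_type_Flex_inv in Ht as (_ & _ & Fx). unfold inst.
    rewrite size_rename, (Forall2_length Fx). lia.
Qed.

(** * Updating solutions at fresh variables, and typing of the bindings *)

Definition set (psi : subst) (H : fvar) (u : tm) : subst :=
  fun Y => if fvar_eq_dec Y H then u else psi Y.

Lemma set_eq psi H u : set psi H u H = u.
Proof. unfold set. destruct (fvar_eq_dec H H); congruence. Qed.

Lemma set_neq psi H u Y : Y <> H -> set psi H u Y = psi Y.
Proof. unfold set. destruct (fvar_eq_dec Y H); congruence. Qed.

Lemma wf_set psi H u : wf_subst psi -> has_type [] u (snd H) -> wf_subst (set psi H u).
Proof.
  intros [Ht [l Hl]] Hu. split.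
  - intros X. unfold set. destruct (fvar_eq_dec X H) as [->|]; auto.
  - exists (H :: l). intros X HX. simpl in HX. rewrite set_neq; firstorder congruence.
Qed.

Lemma wf_eps : wf_subst eps.
Proof. split; [exact etaX_typed | exists []; auto]. Qed.

Lemma wf_upd F u : has_type [] u (snd F) -> wf_subst (upd F u).
Proof. apply (wf_set eps). apply wf_eps. Qed.

Lemma wf_upd2 F u G v :
  has_type [] u (snd F) -> has_type [] v (snd G) -> wf_subst (upd2 F u G v).
Proof. intros. apply (wf_set (set eps G v)); auto. apply wf_set; auto using wf_eps. Qed.

Lemma wf_compose sg th : wf_subst sg -> wf_subst th -> wf_subst (compose sg th).
Proof.
  intros [Hs [l1 H1]] [Ht [l2 H2]]. split.
  - intros X. now apply sapp_typed.
  - exists (l1 ++ l2). intros X HX. rewrite in_app_iff in HX. unfold compose.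
    rewrite H1, sapp_etaX, H2; tauto.
Qed.

Lemma index_of_in j l : In j l -> index_of j l < length l /\ nth (index_of j l) l 0 = j.
Proof.
  induction l as [|x l IH]; simpl; [tauto|]. intros [->|H].
  - rewrite Nat.eqb_refl. split; auto; lia.
  - destruct (Nat.eqb_spec j x) as [->|_]; [split; auto; lia|]. destruct (IH H); split; auto; lia.
Qed.

Lemma index_of_nth l k : NoDup l -> k < length l -> index_of (nth k l 0) l = k.
Proof.
  intros N Hk. destruct (index_of_in (nth k l 0) l) as [H1 H2]; [now apply nth_In|].
  rewrite NoDup_nth in N. apply (N _ _ H1 Hk H2).
Qed.

(* If [b] depends only on the binders at positions [pos], this is the renaming that turns it
   into the body of an abstraction over these binders alone. *)
Definition prune (n : nat) (pos : list nat) (i : nat) : nat :=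
  length pos - 1 - index_of (n - 1 - i) pos.

(** Common core of SV and VE2. The expression [length args - 1 - i] turns an index into an argument
    position. The new arguments [f] of [H] are arbitrary so that the same value of [H] serves the
    binding of [F] and, in VE2, also that of the other variable. *)
Lemma prune_subst psi F pos b H :
  wf_subst psi -> snd H = pos_type F pos -> NoDup pos ->
  has_type (rev (args_of (snd F))) b (Base (res_of (snd F))) ->
  (forall k, In k pos -> k < length (args_of (snd F))) ->
  (forall i, bfree i b -> In (length (args_of (snd F)) - 1 - i) pos) ->
  let psi' := set psi H (lams (map (fun k => nth k (args_of (snd F)) (Base 0)) pos)
                (rename (prune (length (args_of (snd F))) pos) b)) in
  wf_subst psi' /\
  forall As f, sapp psi' (lams As (Flex H (map f pos))) =
    lams As (rename (fun i => f (length (args_of (snd F)) - 1 - i)) b).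
Proof.
  set (args := args_of (snd F)). set (n := length args).
  intros Hpsi EH N Hb Hlt Hpos psi'.
  assert (Hlen : forall i, bfree i b -> i < n).
  { intros i Hi. assert (Q := bfree_typed _ _ _ _ Hb Hi). now rewrite length_rev in Q. }
  split.
  - apply wf_set; auto. rewrite EH. apply has_type_lams. rewrite app_nil_r.
    eapply rename_typed; eauto; unfold prune.
    + intros i A Hi HA. destruct (index_of_in _ _ (Hpos i Hi)) as [H1 H2].
      specialize (Hlen i Hi).
      rewrite nth_error_rev_sub in HA by auto. fold n in HA.
      rewrite nth_error_rev_sub; rewrite length_map; [|lia].
      rewrite nth_error_map.
      replace (length pos - 1 - (length pos - 1 - index_of (n - 1 - i) pos))
        with (index_of (n - 1 - i) pos) by lia.
      rewrite (nth_error_nth' pos 0) by auto. rewrite H2. simpl. f_equal.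
      now apply nth_error_nth.
    + intros i j Hi Hj E.
      destruct (index_of_in _ _ (Hpos i Hi)) as [H1 H2].
      destruct (index_of_in _ _ (Hpos j Hj)) as [H3 H4].
      specialize (Hlen i Hi) as Li. specialize (Hlen j Hj) as Lj.
      assert (E' : index_of (n - 1 - i) pos = index_of (n - 1 - j) pos) by lia.
      rewrite E' in H2. lia.
  - intros As f. rewrite sapp_lams. f_equal. simpl. unfold psi'. rewrite set_eq.
    rewrite inst_lams by now rewrite !length_map. rewrite rename_rename. apply rename_ext.
    intros i Hi. destruct (index_of_in _ _ (Hpos i Hi)) as [H1 H2].
    unfold prune, ins. rewrite length_map.
    destruct (Nat.ltb_spec (length pos - 1 - index_of (n - 1 - i) pos) (length pos)); [|lia].
    replace (length pos - 1 - (length pos - 1 - index_of (n - 1 - i) pos))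
        with (index_of (n - 1 - i) pos) by lia.
    rewrite nth_indep with (d' := f 0) by (rewrite length_map; lia).
    rewrite map_nth. now rewrite H2.
Qed.

(** The binders [As] are kept apart from the arguments of [F] because, in VE2, [H] takes its type
    from [F] but also occurs in the binding of the second variable. *)
Lemma pos_binding_typed F pos H As f :
  snd H = pos_type F pos -> NoDup (map f pos) ->
  (forall k, In k pos ->
    nth_error (rev As) (f k) = Some (nth k (args_of (snd F)) (Base 0))) ->
  has_type [] (lams As (Flex H (map f pos))) (arrows As (Base (res_of (snd F)))).
Proof.
  intros E N Hf. apply has_type_lams. rewrite app_nil_r.
  replace (res_of (snd F)) with (res_of (snd H))
    by (rewrite E; unfold pos_type; now rewrite res_of_arrows).
  constructor; auto. rewrite E. unfold pos_type. rewrite args_of_arrows. simpl.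
  rewrite app_nil_r. apply Forall2_map_same, Forall_forall. auto.
Qed.

Lemma pos_binding_self_typed F pos H n :
  snd H = pos_type F pos -> NoDup pos -> n = length (args_of (snd F)) ->
  (forall k, In k pos -> k < n) ->
  has_type [] (lams (args_of (snd F)) (Flex H (map (fun k => n - 1 - k) pos))) (snd F).
Proof.
  intros E N -> Hlt. refine (eq_ind _ (has_type [] _) _ _ (arrows_args (snd F))).
  apply pos_binding_typed; auto.
  - apply NoDup_map_NoDup_ForallPairs; auto. intros x y Hx Hy.
    apply Hlt in Hx, Hy. lia.
  - intros k Hk. apply Hlt in Hk. rewrite nth_error_rev_sub by lia.
    rewrite (nth_error_nth' _ (Base 0)) by lia. do 2 f_equal. lia.
Qed.

Lemma upd_other F u psi' Y : typed_subst psi' -> Y <> F -> sapp psi' (upd F u Y) = psi' Y.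
Proof.
  intros Hpsi N. unfold upd. destruct (fvar_eq_dec Y F); [tauto|]. now apply sapp_etaX.
Qed.

Lemma in_seq_filter f n k : In k (filter f (seq 0 n)) <-> k < n /\ f k = true.
Proof. rewrite filter_In, in_seq. intuition lia. Qed.

Lemma bfree_rename t : forall r i, bfree i t -> bfree (r i) (rename r t).
Proof.
  induction t as [A t IH|h ts IH|X xs] using tm_nested_ind; intros r i Hi; inversion Hi; subst;
    simpl; eauto using in_map.
  - constructor. change (S (r i)) with (up r (S i)). auto.
  - rewrite Forall_forall in IH. eauto using in_map.
Qed.

Lemma bfree_rename_inv t : forall r j,
  bfree j (rename r t) -> exists i, j = r i /\ bfree i t.
Proof.
  induction t as [A t IH|h ts IH|X xs] using tm_nested_ind; intros r j Hj;
    simpl in Hj; inversion Hj as [? ? ? Hj'| |? ? u ? Hu Hj'|? ? ? Hj']; subst.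
  - destruct (IH _ _ Hj') as ([|i] & E & Hi); simpl in E; [discriminate|].
    injection E as ->. eauto.
  - destruct h; simpl in *; try discriminate.
    match goal with E : HB _ = HB _ |- _ => injection E as -> end. eauto.
  - apply in_map_iff in Hu as (v & <- & Hv). rewrite Forall_forall in IH.
    destruct (IH v Hv _ _ Hj') as (i & -> & Hi). eauto.
  - apply in_map_iff in Hj' as (i & <- & Hi). eauto.
Qed.

(** Interprets at once all the variables introduced by an imitation; as they are distinct, no update
    overwrites another. *)
Lemma set_many psi args Hs cs :
  wf_subst psi -> NoDup Hs ->
  Forall2 (fun H c => has_type [] (lams args c) (snd H)) Hs cs ->
  exists psi', wf_subst psi' /\ (forall Y, ~ In Y Hs -> psi' Y = psi Y) /\
    Forall2 (fun H c => psi' H = lams args c) Hs cs.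
Proof.
  intros Hpsi N F. revert N. induction F as [|H c Hs cs Hc F IH]; intros N.
  - exists psi. auto.
  - inversion N as [|? ? HH N']; subst. destruct (IH N') as (psi' & Hwf & Hout & Hin).
    exists (set psi' H (lams args c)). repeat split.
    + apply wf_set; auto.
    + apply wf_set; auto.
    + intros Y HY. simpl in HY. rewrite set_neq by (intros ->; tauto). apply Hout. tauto.
    + constructor; [apply set_eq|]. revert Hin. apply Forall2_mono.
      intros H' c' HH' E. rewrite set_neq; auto. intros ->; auto.
Qed.

(** * Occurrences and fresh variables *)

Definition esize (psi : subst) (P : list eqn) : nat :=
  list_sum (map (fun e => size (sapp psi (fst e)) + size (sapp psi (snd e))) P).

Lemma esize_cons psi e P :
  esize psi (e :: P) = size (sapp psi (fst e)) + size (sapp psi (snd e)) + esize psi P.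
Proof. reflexivity. Qed.

Lemma esize_app psi P1 P2 : esize psi (P1 ++ P2) = esize psi P1 + esize psi P2.
Proof. unfold esize. now rewrite map_app, list_sum_app. Qed.

Lemma esize_middle psi P1 e P2 :
  esize psi (P1 ++ e :: P2) =
  size (sapp psi (fst e)) + size (sapp psi (snd e)) + esize psi (P1 ++ P2).
Proof. rewrite !esize_app, esize_cons. lia. Qed.

Lemma esize_combine psi ts ss :
  length ts = length ss ->
  esize psi (combine ts ss) =
  list_sum (map size (map (sapp psi) ts)) + list_sum (map size (map (sapp psi) ss)).
Proof.
  revert ss. induction ts as [|t ts IH]; intros [|s ss] L; simpl in *; try discriminate; auto.
  rewrite esize_cons, IH by lia. simpl. lia.
Qed.

(** Second component of the termination measure. Ori leaves the total instance size unchanged, but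
    turns a rigid left-hand side into a flexible one. *)
Definition rig_count (P : list eqn) : nat :=
  length (filter (fun e => match fst e with Rig _ _ => true | _ => false end) P).

Lemma rig_count_middle P1 e P2 :
  rig_count (P1 ++ e :: P2) = rig_count [e] + rig_count (P1 ++ P2).
Proof.
  unfold rig_count. rewrite !filter_app, !length_app. simpl.
  destruct (match fst e with Rig _ _ => true | _ => false end); simpl; lia.
Qed.

Lemma used_eqs_map th P Y :
  used_eqs (map (eapp th) P) Y -> exists Z, used_eqs P Z /\ occb Y (th Z) = true.
Proof.
  intros (e' & He' & HY). apply in_map_iff in He' as (e & <- & He).
  destruct HY as [HY|HY]; apply occb_sapp in HY as (Z & HZ & HY); exists Z; split; auto;
    exists e; auto.
Qed.

Definition finite_set (W : fvar -> Prop) : Prop :=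
  exists l : list fvar, forall X, W X -> In X l.

Fixpoint fv (t : tm) : list fvar :=
  match t with
  | Lam _ u => fv u
  | Rig _ ts => flat_map fv ts
  | Flex X _ => [X]
  end.

Lemma occb_fv X t : occb X t = true -> In X (fv t).
Proof.
  induction t as [A t IH|h ts IH|Y xs] using tm_nested_ind; simpl; auto.
  - rewrite existsb_exists, in_flat_map, Forall_forall in *. intros (u & Hu & HX). eauto.
  - rewrite fvar_eqb_spec. auto.
Qed.

Lemma used_finite U P sg : finite_set U -> wf_subst sg -> finite_set (used U P sg).
Proof.
  intros [l Hl] [_ [l' Hl']].
  assert (Hd : forall X, in_dom sg X -> In X l').
  { intros X HX. apply NNPP. intros N. apply HX. auto. }
  exists (l ++ flat_map (fun e => fv (fst e) ++ fv (snd e)) P ++ l' ++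
    flat_map (fun Y => fv (sg Y)) l').
  intros X HX. rewrite !in_app_iff, !in_flat_map.
  destruct HX as [HX|[(e & He & HX)|[HX|(Y & HY & HX)]]]; auto.
  - right; left. exists e. split; auto. rewrite in_app_iff. destruct HX; auto using occb_fv.
  - do 3 right. exists Y. auto using occb_fv.
Qed.

(** Names are pairs of a number and a type, so any number above all those in use is fresh at every
    type; consecutive numbers give distinct names. *)
Lemma fresh_list W : finite_set W -> forall Ts,
  exists Hs, NoDup Hs /\ Forall (fun H => ~ W H) Hs /\ map snd Hs = Ts.
Proof.
  intros [l Hl].
  assert (Hb : exists N, forall X, In X l -> fst X < N).
  { clear. induction l as [|Y l [N IH]]; [exists 0; simpl; tauto|].
    exists (S (fst Y + N)). intros X [<-|HX]; [lia|]. apply IH in HX. lia. }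
  destruct Hb as [N HN]. intros Ts.
  enough (exists Hs : list fvar, NoDup Hs /\ Forall (fun H => N <= fst H) Hs /\ map snd Hs = Ts)
    as (Hs & H1 & H2 & H3).
  { exists Hs. repeat split; auto. revert H2. apply Forall_impl. intros H HH HW.
    apply Hl, HN in HW. lia. }
  clear HN. revert N. induction Ts as [|T Ts IH]; intros N.
  - exists []. repeat split; constructor.
  - destruct (IH (S N)) as (Hs & H1 & H2 & H3). exists ((N, T) :: Hs).
    rewrite Forall_forall in *. repeat split.
    + constructor; auto. intros HI. apply H2 in HI. simpl in HI. lia.
    + intros H [<-|HI]; simpl; auto. apply H2 in HI. lia.
    + simpl. congruence.
Qed.

(** Looks through abstractions because the left-hand sides created by VE1 are eta-expanded. *)
Fixpoint lhead (t : tm) : option fvar :=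
  match t with
  | Lam _ u => lhead u
  | Rig _ _ => None
  | Flex X _ => Some X
  end.

Lemma lhead_occb X t : lhead t = Some X -> occb X t = true.
Proof.
  induction t as [A t IH|h ts IH|Y xs] using tm_nested_ind; simpl; auto; try discriminate.
  intros [= ->]. now apply fvar_eqb_spec.
Qed.

Lemma lhead_lams As t : lhead (lams As t) = lhead t.
Proof. induction As; simpl; auto. Qed.

Lemma lhead_eta_app H xs : lhead (eta_app H xs) = Some H.
Proof. apply lhead_lams. Qed.

Lemma lhead_sapp th X t : forall G T,
  has_type G t T -> lhead t = Some X -> th X = etaX X -> lhead (sapp th t) = Some X.
Proof.
  induction t as [A t IH|h ts IH|Y xs] using tm_nested_ind; intros G T Ht E Eth; simpl in *.
  - apply has_type_Lam_inv in Ht as (B & -> & Ht). eauto.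
  - discriminate.
  - injection E as ->. apply has_type_Flex_inv in Ht as (-> & _ & F).
    rewrite Eth, inst_etaX by (eapply Forall2_length; eauto). reflexivity.
Qed.

(* The shape of the problems reached by VarElim: each left-hand side is an abstracted
   [H(x1,...,xn)], with [H] in no other left-hand side and in no right-hand side. *)
Definition ve_linear (P : list eqn) : Prop :=
  (forall e, In e P -> lhead (fst e) <> None) /\
  NoDup (map (fun e => lhead (fst e)) P) /\
  forall e e' X, In e P -> In e' P -> lhead (fst e) = Some X -> occb X (snd e') = false.

(** * Similarity of terms at a fixed degree *)

Section Similarity.
Context (RA : cst -> cst -> R) (D : R).
Context (HRA : is_similarity RA) (HD : (0 < D <= 1)%R).

Definition hsim (h g : head) : Prop := (Rh RA h g >= D)%R.

Inductive sim : tm -> tm -> Prop :=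
| sim_Lam A t s : sim t s -> sim (Lam A t) (Lam A s)
| sim_Rig h g ts ss : hsim h g -> Forall2 sim ts ss -> sim (Rig h ts) (Rig g ss)
| sim_Flex X xs : sim (Flex X xs) (Flex X xs).

Lemma sim_Lam_inv A t u : sim (Lam A t) u -> exists s, u = Lam A s /\ sim t s.
Proof using. inversion 1; eauto. Qed.

Lemma sim_Rig_inv h ts u :
  sim (Rig h ts) u -> exists g ss, u = Rig g ss /\ hsim h g /\ Forall2 sim ts ss.
Proof using. inversion 1; eauto. Qed.

Lemma sim_Flex_inv X xs u : sim (Flex X xs) u -> u = Flex X xs.
Proof using. inversion 1; auto. Qed.

Lemma Rmin_ge_iff a b : (Rmin a b >= D <-> a >= D /\ b >= D)%R.
Proof. unfold Rmin. destruct (Rle_dec a b); lra. Qed.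

(** Turns computations with minima into structural reasoning. [0 < D] excludes mismatched shapes,
    where [Rt] is 0, and [D <= 1] admits equal flexible terms, where it is 1. *)
Lemma Rt_sim t : forall s, (Rt RA t s >= D)%R <-> sim t s.
Proof using HD.
  induction t as [A t IH|h ts IH|X xs] using tm_nested_ind; intros [B s|g ss|Y ys];
    try (simpl; split; [lra | inversion 1]; fail).
  - simpl. destruct (ty_eq_dec A B) as [->|N].
    + rewrite IH. split; [now constructor | now inversion 1].
    + split; [lra | inversion 1; congruence].
  - simpl. rewrite Rmin_ge_iff.
    match goal with |- _ /\ ?x <-> _ => assert (E : x <-> Forall2 sim ts ss) end.
    { revert ss. induction IH as [|u us Hu _ IHus]; intros [|v vs];
        try (split; [lra | inversion 1]; fail).
      - split; [constructor | lra].
      - rewrite Rmin_ge_iff, Hu, IHus. split; [intros []; auto | now inversion 1]. }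
    rewrite E. split; [intros []; now constructor | inversion 1; auto].
  - simpl. destruct (fvar_eq_dec X Y) as [->|N].
    + destruct (list_eq_dec Nat.eq_dec xs ys) as [->|N].
      * split; [constructor | lra].
      * split; [lra | inversion 1; congruence].
    + split; [lra | inversion 1; congruence].
Qed.

Lemma hsim_refl h : hsim h h.
Proof using HRA HD.
  destruct HRA as (_ & Hr & _). destruct h as [c|i]; unfold hsim; simpl.
  - rewrite Hr. lra.
  - destruct (Nat.eq_dec i i); [lra | congruence].
Qed.

Lemma hsim_sym h g : hsim h g -> hsim g h.
Proof using HRA.
  destruct HRA as (_ & _ & Hs & _). destruct h as [c|i], g as [c'|j]; unfold hsim; simpl; auto.
  - now rewrite Hs.
  - destruct (Nat.eq_dec i j), (Nat.eq_dec j i); subst; auto; congruence.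
Qed.

Lemma hsim_HB i h : hsim (HB i) h -> h = HB i.
Proof using HD.
  destruct h as [c|j]; unfold hsim; simpl; [lra|].
  destruct (Nat.eq_dec i j); [congruence | lra].
Qed.

(** Constants of different types have degree 0 < [D]. Similar heads therefore take the same number
    of arguments, of the same types. *)
Lemma hsim_HC c h : hsim (HC c) h -> exists c', h = HC c' /\ snd c = snd c'.
Proof using HRA HD.
  destruct HRA as (_ & _ & _ & _ & Ht).
  destruct h as [c'|j]; unfold hsim; simpl; [|lra]. intros H. exists c'. split; auto.
  destruct (ty_eq_dec (snd c) (snd c')); auto. rewrite Ht in H; auto; lra.
Qed.

Lemma hsim_trans h g k : hsim h g -> hsim g k -> hsim h k.
Proof using HRA HD.
  intros H1 H2. destruct h as [c|i].
  - destruct (hsim_HC _ _ H1) as (c' & -> & _). destruct (hsim_HC _ _ H2) as (c'' & -> & _).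
    destruct HRA as (_ & _ & _ & Ht & _). unfold hsim in *. simpl in *.
    specialize (Ht c c' c''). assert (Rmin (RA c c') (RA c' c'') >= D)%R by now apply Rmin_ge_iff.
    lra.
  - apply hsim_HB in H1 as ->. auto.
Qed.

Lemma hsim_rn r h g : hsim h g -> hsim (rn_head r h) (rn_head r g).
Proof using HRA HD.
  intros H. destruct h as [c|i].
  - destruct (hsim_HC _ _ H) as (c' & -> & _). auto.
  - apply hsim_HB in H as ->. apply hsim_refl.
Qed.

Lemma head_type_hsim G h g A : head_type G h A -> hsim h g -> head_type G g A.
Proof using HRA HD.
  intros Hh H. destruct h as [c|i].
  - destruct (hsim_HC _ _ H) as (c' & -> & E). simpl in *. congruence.
  - apply hsim_HB in H as ->. auto.
Qed.

Lemma sim_refl t : sim t t.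
Proof using HRA HD.
  induction t as [A t IH|h ts IH|X xs] using tm_nested_ind; constructor; auto using hsim_refl.
  induction IH; auto.
Qed.

Lemma sim_sym t : forall s, sim t s -> sim s t.
Proof using HRA.
  induction t as [A t IH|h ts IH|X xs] using tm_nested_ind; intros s H.
  - apply sim_Lam_inv in H as (s' & -> & H). constructor; auto.
  - apply sim_Rig_inv in H as (g & ss & -> & Hh & F). constructor; auto using hsim_sym.
    clear Hh. induction F; inversion IH; subst; constructor; auto.
  - apply sim_Flex_inv in H as ->. constructor.
Qed.

Lemma sim_trans t : forall s u, sim t s -> sim s u -> sim t u.
Proof using HRA HD.
  induction t as [A t IH|h ts IH|X xs] using tm_nested_ind; intros s u H1 H2.
  - apply sim_Lam_inv in H1 as (s' & -> & H1). apply sim_Lam_inv in H2 as (u' & -> & H2).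
    constructor; eauto.
  - apply sim_Rig_inv in H1 as (g & ss & -> & Hh1 & F1).
    apply sim_Rig_inv in H2 as (k & us & -> & Hh2 & F2).
    constructor; eauto using hsim_trans. clear Hh1 Hh2. revert us F2.
    induction F1; intros us F2; inversion F2; inversion IH; subst; constructor; eauto.
  - apply sim_Flex_inv in H1 as ->. auto.
Qed.

Lemma sim_rename t : forall s r, sim t s -> sim (rename r t) (rename r s).
Proof using HRA HD.
  induction t as [A t IH|h ts IH|X xs] using tm_nested_ind; intros s r H.
  - apply sim_Lam_inv in H as (s' & -> & H). simpl. constructor; auto.
  - apply sim_Rig_inv in H as (g & ss & -> & Hh & F). simpl. constructor; auto using hsim_rn.
    apply (Forall2_maps sim (rename r) (rename r)). revert F.
    apply Forall2_mono. rewrite Forall_forall in IH. auto.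
  - apply sim_Flex_inv in H as ->. constructor.
Qed.

Lemma sim_size t : forall s, sim t s -> size t = size s.
Proof using.
  induction t as [A t IH|h ts IH|X xs] using tm_nested_ind; intros s H.
  - apply sim_Lam_inv in H as (s' & -> & H). simpl. auto.
  - apply sim_Rig_inv in H as (g & ss & -> & Hh & F). simpl. f_equal. clear Hh.
    induction F; inversion IH; subst; simpl; auto.
  - apply sim_Flex_inv in H as ->. auto.
Qed.

(** A bound variable is similar only to itself. In VE2 this confines the instance of [F] to the
    variables shared by both argument lists. *)
Lemma sim_bfree t : forall s i, sim t s -> bfree i t -> bfree i s.
Proof using HD.
  induction t as [A t IH|h ts IH|X xs] using tm_nested_ind; intros s i H Hi.
  - apply sim_Lam_inv in H as (s' & -> & H). inversion Hi; subst. auto.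
  - apply sim_Rig_inv in H as (g & ss & -> & Hh & F). inversion Hi as [| |? ? u ? Hu Hui|]; subst.
    + apply hsim_HB in Hh as ->. auto.
    + rewrite Forall_forall in IH. apply In_nth_error in Hu as Hk. destruct Hk as [k Hk].
      apply Forall2_flip in F. destruct (Forall2_lookup _ _ _ F _ _ Hk) as (v & Hv & Huv).
      apply nth_error_In in Hv. eauto.
  - apply sim_Flex_inv in H as ->. auto.
Qed.

Lemma sim_strip n : forall u v, sim u v -> sim (strip n u) (strip n v).
Proof using. induction n as [|n IH]; intros u v H; inversion H; subst; simpl; auto. Qed.

Lemma sim_lams As b c : sim b c -> sim (lams As b) (lams As c).
Proof using. intros H. induction As; simpl; auto. now constructor. Qed.

Lemma sapp_sim th1 th2 t :
  (forall X, occb X t = true -> sim (th1 X) (th2 X)) -> sim (sapp th1 t) (sapp th2 t).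
Proof using HRA HD.
  induction t as [A t IH|h ts IH|X xs] using tm_nested_ind; intros H; simpl in *.
  - constructor; auto.
  - constructor; [apply hsim_refl|]. apply Forall2_map_same. rewrite Forall_forall in *.
    intros u Hu. apply IH; auto. intros X HX. apply H. apply existsb_exists; eauto.
  - apply sim_rename, sim_strip, H. now apply fvar_eqb_spec.
Qed.

(** Both renamings act on the same term, and at an occurrence of a bound variable similarity is
    equality. In SV it shows that a body uses only the positions at which both argument lists
    agree. *)
Lemma sim_rename_agree t : forall r1 r2 i,
  sim (rename r1 t) (rename r2 t) -> bfree i t -> r1 i = r2 i.
Proof using HD.
  induction t as [A t IH|h ts IH|X xs] using tm_nested_ind; intros r1 r2 i H Hi;
    simpl in H; inversion Hi as [? ? ? Hi'| |? ? u ? Hu Hi'|? ? ? Hi']; subst.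
  - apply sim_Lam_inv in H as (s' & [= <-] & H). specialize (IH _ _ _ H Hi').
    simpl in IH. congruence.
  - apply sim_Rig_inv in H as (g & ss & [= <- <-] & Hh & F). apply hsim_HB in Hh.
    simpl in Hh. congruence.
  - apply sim_Rig_inv in H as (g & ss & [= <- <-] & Hh & F).
    apply (Forall2_maps sim (rename r1) (rename r2)) in F.
    rewrite Forall_forall in IH. apply (IH u); auto. clear - F Hu.
    induction ts; inversion F; subst; destruct Hu; subst; auto.
  - apply sim_Flex_inv in H. injection H as H. symmetry. apply ext_in_map with (1 := H). auto.
Qed.

(** * Refining a solution by a substitution *)

Definition refines (psi th psi' : subst) (W : fvar -> Prop) : Prop :=
  wf_subst th /\ wf_subst psi' /\ forall Y, W Y -> sim (sapp psi' (th Y)) (psi Y).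

Definition solved (psi : subst) (e : eqn) : Prop :=
  exists G T, has_type G (fst e) T /\ has_type G (snd e) T /\
    sim (sapp psi (fst e)) (sapp psi (snd e)).

Lemma refines_sapp psi th psi' W G t T :
  refines psi th psi' W -> has_type G t T -> (forall X, occb X t = true -> W X) ->
  sim (sapp psi' (sapp th t)) (sapp psi t).
Proof using HRA HD.
  intros ([Hth _] & [Hpsi' _] & H) Ht HW.
  rewrite (sapp_sapp th psi' t G T) by auto. apply sapp_sim. intros X HX. apply H; auto.
Qed.

(** Applying a binding leaves the measure unchanged, since old and new instances are similar; all
    decrease comes from the equation that is removed. *)
Lemma refines_eqs psi th psi' W P :
  refines psi th psi' W -> Forall (solved psi) P -> (forall X, used_eqs P X -> W X) ->
  Forall (solved psi') (map (eapp th) P) /\ esize psi' (map (eapp th) P) = esize psi P.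
Proof using HRA HD.
  intros Hr HP HW. induction HP as [|[l r] P (G & T & Hl & Hr' & Hs) HP IH]; simpl in *; auto.
  destruct IH as [IH1 IH2].
  { intros X (e & He & HX). apply HW. exists e. simpl; auto. }
  assert (Sl := refines_sapp _ _ _ _ _ _ _ Hr Hl).
  assert (Sr := refines_sapp _ _ _ _ _ _ _ Hr Hr').
  specialize (Sl (fun X HX => HW X (ex_intro _ (l, r) (conj (or_introl eq_refl) (or_introl HX))))).
  specialize (Sr (fun X HX => HW X (ex_intro _ (l, r) (conj (or_introl eq_refl) (or_intror HX))))).
  split.
  - constructor; auto. exists G, T. simpl. destruct Hr as ([Hth _] & _).
    repeat split; auto using sapp_typed.
    eapply sim_trans; [exact Sl|]. eapply sim_trans; [exact Hs|]. now apply sim_sym.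
  - unfold esize in *. simpl. rewrite IH2, (sim_size _ _ Sl), (sim_size _ _ Sr). reflexivity.
Qed.

(** * New solutions for the bindings of SV, VE2 and VE1 *)

(** The case of SV: the body of [psi F] ignores the positions where [xs] and [ys] differ, so its
    pruned form is a value for [H] from which [psi F] is recovered exactly. *)
Lemma same_var_refines psi F xs ys H G T :
  wf_subst psi -> has_type G (Flex F xs) T -> has_type G (Flex F ys) T ->
  sim (inst (psi F) xs) (inst (psi F) ys) ->
  snd H = pos_type F (sv_pos xs ys) -> H <> F ->
  exists psi', refines psi (upd F (sv_binding F xs ys H)) psi' (fun Y => Y <> H).
Proof using HRA HD.
  intros Hpsi Hx Hy Hs EH NHF.
  apply has_type_Flex_inv in Hx as (_ & Nx & Fx). apply has_type_Flex_inv in Hy as (_ & Ny & Fy).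
  apply Forall2_length in Fx, Fy.
  destruct (closed_lams _ _ (proj1 Hpsi F)) as (b & Eb & Hb).
  rewrite Eb, !inst_lams in Hs by auto.
  assert (Hlen : forall i, bfree i b -> i < length (args_of (snd F))).
  { intros i Hi. assert (Q := bfree_typed _ _ _ _ Hb Hi). now rewrite length_rev in Q. }
  assert (Np : NoDup (sv_pos xs ys)) by apply NoDup_filter, seq_NoDup.
  assert (Hlt : forall k, In k (sv_pos xs ys) -> k < length (args_of (snd F))).
  { intros k Hk. apply in_seq_filter in Hk. lia. }
  edestruct (prune_subst psi F (sv_pos xs ys) b H) as [Hwf Hp]; eauto.
  { intros i Hi. apply in_seq_filter. specialize (Hlen i Hi). split; [lia|].
    apply Nat.eqb_eq. assert (E := sim_rename_agree _ _ _ _ Hs Hi). unfold ins in E.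
    rewrite Fx, Fy in E. destruct (Nat.ltb_spec i (length (args_of (snd F)))); [exact E|lia]. }
  eexists; split; [|split; [exact Hwf|]].
  - apply wf_upd. unfold sv_binding. apply pos_binding_self_typed; auto.
    intros k Hk. rewrite Fx. auto.
  - intros Y NY. destruct (fvar_eq_dec Y F) as [->|NYF].
    + unfold upd. destruct (fvar_eq_dec F F); [|tauto]. unfold sv_binding. rewrite Hp, Eb.
      apply sim_lams. rewrite rename_id; [apply sim_refl|].
      intros i Hi. apply Hlen in Hi. simpl. lia.
    + rewrite upd_other by (auto; exact (proj1 Hwf)). rewrite set_neq by auto. apply sim_refl.
Qed.

(** The case of VE2: [H] receives the pruned body of [psi F]. This recovers [psi F] exactly, but
    [psi F'] only up to similarity. *)
Lemma distinct_vars_refines psi F xs F' ys H G T :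
  wf_subst psi -> has_type G (Flex F xs) T -> has_type G (Flex F' ys) T ->
  sim (inst (psi F) xs) (inst (psi F') ys) ->
  snd H = pos_type F (ve2_pos xs ys) -> H <> F -> H <> F' -> F <> F' ->
  exists psi',
    refines psi (upd2 F (ve2_bindingF F xs ys H) F' (ve2_bindingG F' xs ys H)) psi'
      (fun Y => Y <> H).
Proof using HRA HD.
  intros Hpsi Hx Hy Hs EH NHF NHF' NFF'.
  apply has_type_Flex_inv in Hx as (-> & Nx & Fx).
  apply has_type_Flex_inv in Hy as (ET & Ny & Fy).
  injection ET as ET.
  assert (Lx := Forall2_length Fx). assert (Ly := Forall2_length Fy).
  destruct (closed_lams _ _ (proj1 Hpsi F)) as (b & Eb & Hb).
  destruct (closed_lams _ _ (proj1 Hpsi F')) as (c & Ec & Hc).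
  rewrite Eb, Ec, !inst_lams in Hs by auto.
  assert (Hlen : forall i, bfree i b -> i < length (args_of (snd F))).
  { intros i Hi. assert (Q := bfree_typed _ _ _ _ Hb Hi). now rewrite length_rev in Q. }
  assert (Hlen' : forall i, bfree i c -> i < length (args_of (snd F'))).
  { intros i Hi. assert (Q := bfree_typed _ _ _ _ Hc Hi). now rewrite length_rev in Q. }
  assert (Np : NoDup (ve2_pos xs ys)) by apply NoDup_filter, seq_NoDup.
  assert (Hpos : forall k, In k (ve2_pos xs ys) <-> k < length xs /\ In (nth k xs 0) ys).
  { intros k. unfold ve2_pos. rewrite in_seq_filter, existsb_exists.
    split; intros [H1 H2]; split; auto.
    - destruct H2 as (x & Hx & E). apply Nat.eqb_eq in E. congruence.
    - exists (nth k xs 0). split; auto. apply Nat.eqb_refl. }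
  assert (Hlt : forall k, In k (ve2_pos xs ys) -> k < length (args_of (snd F))).
  { intros k Hk. apply Hpos in Hk. lia. }
  assert (Hins : forall i, i < length xs -> ins xs i = nth (length xs - 1 - i) xs 0).
  { intros i Hi. unfold ins. destruct (Nat.ltb_spec i (length xs)); [auto|lia]. }
  edestruct (prune_subst psi F (ve2_pos xs ys) b H) as [Hwf Hp]; eauto.
  (* A variable used by the instance of [F] also occurs in the similar instance of [F'], whose free
     indices all come from [ys]. *)
  { intros i Hi. apply Hpos. specialize (Hlen i Hi). split; [lia|]. rewrite <- Lx, <- Hins by lia.
    apply bfree_rename with (r := ins xs) in Hi. apply (sim_bfree _ _ _ Hs) in Hi.
    apply bfree_rename_inv in Hi as (j & -> & Hj). apply Hlen' in Hj. unfold ins.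
    destruct (Nat.ltb_spec j (length ys)); [|lia]. apply nth_In. lia. }
  eexists; split; [|split; [exact Hwf|]].
  - apply wf_upd2.
    + apply pos_binding_self_typed; auto. intros k Hk. rewrite Lx. auto.
    + unfold ve2_bindingG. refine (eq_ind _ (has_type [] _) _ _ (arrows_args (snd F'))).
      rewrite <- ET.
      apply pos_binding_typed; auto.
      * apply NoDup_map_NoDup_ForallPairs; auto. intros k k' Hk Hk' E.
        apply Hpos in Hk as [Hk1 Hk2], Hk' as [Hk1' Hk2'].
        apply index_of_in in Hk2 as [I1 I2], Hk2' as [I1' I2'].
        assert (E' : nth k xs 0 = nth k' xs 0).
        { rewrite <- I2, <- I2'. f_equal. lia. }
        rewrite NoDup_nth in Nx. apply (Nx _ _ Hk1 Hk1' E').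
      * intros k Hk. assert (Hk' := Hk). apply Hlt in Hk'. apply Hpos in Hk as [Hk1 Hk2].
        apply index_of_in in Hk2 as [I1 I2]. rewrite nth_error_rev_sub by lia.
        rewrite <- Ly.
        replace (length ys - 1 - (length ys - 1 - index_of (nth k xs 0) ys))
          with (index_of (nth k xs 0) ys) by lia.
        (* The two argument types agree because each is the type in [G] of the same shared
           variable. *)
        assert (Q := nth_error_nth' (args_of (snd F)) (Base 0) Hk').
        destruct (Forall2_lookup _ _ _ Fx _ _ Q) as (x & Hx & HxG).
        rewrite Ly in I1. assert (Q' := nth_error_nth' (args_of (snd F')) (Base 0) I1).
        destruct (Forall2_lookup _ _ _ Fy _ _ Q') as (y & Hy & HyG).
        rewrite Q'. apply nth_error_nth with (d := 0) in Hx, Hy. congruence.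
  - intros Y NY. unfold upd2. destruct (fvar_eq_dec Y F) as [->|NYF].
    { unfold ve2_bindingF. rewrite Hp, Eb.
      apply sim_lams. rewrite rename_id; [apply sim_refl|].
      intros i Hi. apply Hlen in Hi. lia. }
    destruct (fvar_eq_dec Y F') as [->|NYF'].
    { unfold ve2_bindingG. rewrite Hp, Ec. apply sim_lams.
      (* This renaming is a left inverse of [ins ys] on the indices free in [c]; applied to both
         instances it yields similarity to [c] itself. *)
      apply sim_rename with (r := fun j => length ys - 1 - index_of j ys) in Hs.
      rewrite !rename_rename in Hs. rewrite (rename_id c) in Hs.
      - erewrite rename_ext; [exact Hs|]. intros i Hi. apply Hlen in Hi. simpl.
        rewrite Hins by lia. now rewrite Lx.
      - intros i Hi. apply Hlen' in Hi. unfold ins.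
        destruct (Nat.ltb_spec i (length ys)); [|lia]. rewrite index_of_nth by (auto; lia). lia. }
    rewrite sapp_etaX by exact (proj1 Hwf). rewrite set_neq by auto. apply sim_refl.
Qed.

(** Compares the head [h] of the body of [psi F] with the head [a'] that the rule copies. For
    constants they are merely similar; for a bound variable, distinctness of [xs] leaves only one
    possible position, so they are equal. *)
Lemma rigid_head_cases args xs h A a a' Ta :
  head_type (rev args) h A -> hsim (rn_head (ins xs) h) a -> rigid_in xs args a a' Ta ->
  NoDup xs -> length xs = length args ->
  hsim a' h /\ A = Ta /\ head_type (rev args) a' Ta.
Proof using HRA HD.
  intros Hh Hs Hr N L. destruct h as [c|i]; simpl in *.
  - destruct (hsim_HC _ _ Hs) as (c' & -> & E). inversion Hr; subst.
    split; [now apply hsim_sym|]. simpl. auto.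
  - apply hsim_HB in Hs as ->. inversion Hr as [|k j B Hk HB]; subst.
    assert (Hi : i < length args).
    { rewrite <- length_rev. apply nth_error_Some. congruence. }
    assert (Hk' : k < length xs) by (apply nth_error_Some; congruence).
    apply nth_error_nth with (d := 0) in Hk. unfold ins in Hk.
    destruct (Nat.ltb_spec i (length xs)); [|lia].
    rewrite NoDup_nth in N. apply N in Hk; [|lia..]. subst k.
    replace (length xs - 1 - (length xs - 1 - i)) with i by lia.
    rewrite nth_error_rev_sub in Hh by auto. rewrite L in HB. simpl.
    rewrite nth_error_rev_sub by auto.
    repeat split; auto using hsim_refl; congruence.
Qed.

(** The case of VE1: the body of [psi F] is rigid with a head similar to [a], and each new variable
    receives the abstraction of one of its arguments. The head [h] in the conclusion exposes the
    instance of [F] so that one symbol can be removed from each side. *)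
Lemma imitation_refines psi F xs a ss a' Ta Hs G T :
  wf_subst psi -> has_type G (Flex F xs) T -> has_type G (Rig a ss) T ->
  sim (inst (psi F) xs) (sapp psi (Rig a ss)) ->
  rigid_in xs (args_of (snd F)) a a' Ta -> NoDup Hs -> ~ In F Hs ->
  Forall2 (fun H rho => snd H = arrows (args_of (snd F)) rho) Hs (args_of Ta) ->
  exists psi' h,
    refines psi (upd F (ve1_binding F xs a' Hs)) psi' (fun Y => ~ In Y Hs) /\
    (forall Y, ~ In Y Hs -> psi' Y = psi Y) /\
    inst (psi F) xs = Rig h (map (sapp psi') (map (fun H => eta_app H xs) Hs)) /\
    Forall2 (has_type G) (map (fun H => eta_app H xs) Hs) (args_of Ta) /\
    Forall2 (has_type G) ss (args_of Ta).
Proof using HRA HD.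
  intros Hpsi Hx Ha Hsim Hr N NF FH.
  apply has_type_Flex_inv in Hx as (-> & Nx & Fx). assert (Lx := Forall2_length Fx).
  apply has_type_Rig_inv in Ha as (A1 & HA1 & ET & Fss).
  destruct (closed_lams _ _ (proj1 Hpsi F)) as (b & Eb & Hb).
  set (args := args_of (snd F)) in *.
  rewrite Eb, inst_lams in * by auto. simpl in Hsim.
  destruct b as [A b|h cs|X zs]; simpl in Hsim; inversion Hsim as [|h1 h2 l1 l2 Hh Hl|]; subst.
  apply has_type_Rig_inv in Hb as (A & HA & ET' & Fcs).
  destruct (rigid_head_cases _ _ _ _ _ _ _ HA Hh Hr Nx Lx) as (Hh' & -> & Ha').
  assert (A1 = Ta) as ->.
  { destruct h as [c|i]; simpl in *.
    - destruct (hsim_HC _ _ Hh) as (c' & -> & E). simpl in *. congruence.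
    - apply hsim_HB in Hh as ->. simpl in HA1.
      rewrite (ins_lookup _ _ _ _ _ Fx HA) in HA1. congruence. }
  assert (Fj := Forall2_join _ _ _ _ _ FH Fcs).
  destruct (set_many psi args Hs cs) as (psi' & Hwf & Hout & Hin); auto.
  { revert Fj. apply Forall2_mono. intros H c _ (rho & E & Hc). rewrite E.
    apply has_type_lams. now rewrite app_nil_r. }
  (* Two argument lists are needed: [xs] for the new equations, and the binders themselves for the
     binding of [F]. *)
  assert (Heta : forall zs, length zs = length args ->
    map (sapp psi') (map (fun H => eta_app H zs) Hs) = map (rename (ins zs)) cs).
  { intros zs Lz. rewrite map_map. clear - Fj Hin Lz. revert Hin.
    induction Fj as [|H c Hs cs (rho & E & Hc) _ IH]; inversion 1; subst; simpl; auto.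
    f_equal; auto. eapply sapp_eta_app; eauto. }
  exists psi', (rn_head (ins xs) h). split; [split; [|split; [exact Hwf|]]|].
  - apply wf_upd. unfold ve1_binding. fold args.
    refine (eq_ind _ (has_type [] _) _ _ (arrows_args (snd F))). apply has_type_lams.
    rewrite app_nil_r. rewrite ET'. apply has_type_Rig; auto.
    apply Forall2_map_l. revert FH. apply Forall2_mono. intros H rho _ E.
    apply eta_app_typed with (As := args); auto.
    + apply NoDup_rev, seq_NoDup.
    + rewrite Lx. pose proof (rev_seq_lookup [] args) as Q. now rewrite app_nil_r in Q.
  - intros Y NY. destruct (fvar_eq_dec Y F) as [->|NYF].
    + unfold upd. destruct (fvar_eq_dec F F); [|tauto]. unfold ve1_binding. fold args.
      rewrite sapp_lams, Eb. apply sim_lams. simpl. constructor; auto.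
      rewrite Heta by now rewrite length_rev, length_seq.
      rewrite <- (map_id cs) at 2. apply Forall2_map_same, Forall_forall. intros c Hc.
      rewrite rename_id; [apply sim_refl|]. intros i Hi.
      apply In_nth_error in Hc as [k Hk]. apply Forall2_flip in Fcs.
      destruct (Forall2_lookup _ _ _ Fcs _ _ Hk) as (B & _ & HB).
      eapply bfree_typed in HB; eauto. rewrite length_rev in HB. unfold ins.
      rewrite length_rev, length_seq. destruct (Nat.ltb_spec i (length xs)); [|lia].
      rewrite rev_nth by (rewrite length_seq; lia). rewrite length_seq, seq_nth by lia. lia.
    + rewrite upd_other by (auto; exact (proj1 Hwf)). rewrite Hout by auto. apply sim_refl.
  - repeat split; auto.
    + now rewrite Heta.
    + apply Forall2_map_l. revert FH. apply Forall2_mono. intros H rho _ E.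
      eapply eta_app_typed; eauto.
Qed.

Lemma solved_abs psi A t B s :
  solved psi (Lam A t, Lam B s) -> A = B /\ solved psi (t, s).
Proof using.
  intros (G & T & Ht & Hs & H). simpl in *.
  apply has_type_Lam_inv in Ht as (T1 & -> & Ht).
  apply has_type_Lam_inv in Hs as (T2 & E & Hs). injection E as -> ->.
  apply sim_Lam_inv in H as (s' & [= <-] & H).
  split; auto. exists (B :: G), T2. auto.
Qed.

Lemma solved_combine psi G ts ss As :
  Forall2 (has_type G) ts As -> Forall2 (has_type G) ss As ->
  Forall2 sim (map (sapp psi) ts) (map (sapp psi) ss) ->
  Forall (solved psi) (combine ts ss).
Proof using.
  intros F1. revert ss. induction F1 as [|t A ts As Ht F1 IH]; intros ss F2 F; simpl; auto.
  inversion F2; subst. simpl in *. inversion F; subst. constructor; auto.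
  exists G, A. auto.
Qed.

(** Needed because VE1 does not instantiate the remaining equations; they stay solved since the
    solution changes only at fresh variables. *)
Lemma eqs_ext psi psi' P :
  (forall X, used_eqs P X -> psi' X = psi X) -> Forall (solved psi) P ->
  Forall (solved psi') P /\ esize psi' P = esize psi P.
Proof using.
  intros H HP. induction HP as [|[l r] P (G & T & Hl & Hr & Hs) HP IH]; simpl in *; auto.
  destruct IH as [IH1 IH2].
  { intros X (e & He & HX). apply H. exists e. simpl; auto. }
  assert (El : sapp psi' l = sapp psi l).
  { apply sapp_ext. intros X HX. apply H. exists (l, r). simpl; auto. }
  assert (Er : sapp psi' r = sapp psi r).
  { apply sapp_ext. intros X HX. apply H. exists (l, r). simpl; auto. }
  split.
  - constructor; auto. exists G, T. simpl. rewrite El, Er. auto.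
  - unfold esize in *. simpl. rewrite IH2, El, Er. reflexivity.
Qed.

Lemma refines_compose U P phi psi th psi' W s :
  wf_subst phi -> refines psi th psi' W -> (forall Z, used U P phi Z -> W Z) ->
  (forall Y, U Y -> sim (sapp psi (phi Y)) (s Y)) ->
  forall Y, U Y -> sim (sapp psi' (compose phi th Y)) (s Y).
Proof using HRA HD.
  intros Hphi Hr HW Hs Y HY. eapply sim_trans; [|apply Hs, HY]. unfold compose.
  eapply refines_sapp; eauto; [apply Hphi|]. intros Z HZ. apply HW.
  (* [used] covers the variables in the images of the domain of [phi]; outside that domain, [phi Y]
     contains only [Y], which lies in [U]. *)
  destruct (classic (in_dom phi Y)) as [Hd|Hd].
  - right; right. right. eauto.
  - left. apply NNPP in Hd. rewrite Hd in HZ. unfold etaX in HZ. rewrite occb_eta_app in HZ.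
    apply fvar_eqb_spec in HZ. congruence.
Qed.

(** * Variable elimination: preservation of solutions and existence of a complete run *)

(** [U] holds the variables in use outside, [V] those of the starting equation, and [psi0] is the
    solution before the call. [vi_dom] makes the later restriction to [V] harmless on [U]; [vi_eqs]
    is what keeps [vi_dom] true when a variable of an equation gets bound. *)
Record ve_inv (U V : fvar -> Prop) (psi0 : subst) (P : list eqn) (phi psi : subst) : Prop := {
  vi_phi : wf_subst phi;
  vi_psi : wf_subst psi;
  vi_sim : forall Y, U Y -> sim (sapp psi (phi Y)) (psi0 Y);
  vi_dom : forall Y, U Y -> ~ V Y -> phi Y = etaX Y;
  vi_eqs : forall Y, used_eqs P Y -> U Y -> V Y;
  vi_solved : Forall (solved psi) P
}.

Lemma ve_step_sound U V psi0 P phi P' phi' psi :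
  ve_inv U V psi0 P phi psi -> ve_step U (P, phi) (P', phi') ->
  exists psi', ve_inv U V psi0 P' phi' psi' /\ esize psi' P' < esize psi P.
Proof using HRA HD.
  intros [Hphi Hpsi Hsim Hdom Heqs Hsol] Hstep.
  inversion Hstep as [P1 P2 A t s phi1 E1 E2|P1 P2 F xs a ss phi1 a' Ta Hs Hr L N Hfr FH E1 E2
    |P1 P2 F xs G ys H phi1 NFG Hfr EH E1 E2]; subst; clear Hstep;
    change (tm * tm)%type with eqn in *;
    apply Forall_app in Hsol as [Hsol1 Hsol2]; inversion Hsol2 as [|e P' He Hsol3]; subst;
    clear Hsol2;
    match goal with |- context [P1 ++ ?e :: P2] =>
      assert (Hin : forall X, used_eqs (P1 ++ P2) X -> used_eqs (P1 ++ e :: P2) X) by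
        (intros X (e' & He' & HX); exists e'; split; auto; rewrite in_app_iff in *; simpl; tauto);
      assert (Hine : In e (P1 ++ e :: P2)) by (apply in_elt)
    end;
    assert (Hsol : Forall (solved psi) (P1 ++ P2)) by (apply Forall_app; auto).
  - exists psi. apply solved_abs in He as [_ He]. split.
    + constructor; auto.
      intros Y (e & [<-|He'] & HY) HU; simpl in HY.
      * apply Heqs; auto. exists (Lam A t, Lam A s). auto.
      * apply Heqs; auto. apply Hin. exists e. auto.
    + rewrite esize_middle, esize_cons. simpl. lia.
  - destruct He as (G & T & Hl & Hrt & Hs'). simpl in Hl, Hrt, Hs'.
    assert (HF : used U (P1 ++ (Flex F xs, Rig a ss) :: P2) phi F).
    { right; left. eexists; split; [exact Hine|]. left. now apply fvar_eqb_spec. }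
    rewrite Forall_forall in Hfr.
    assert (NF : ~ In F Hs) by (intros Hi; now apply (Hfr F)).
    destruct (imitation_refines _ _ _ _ _ _ _ _ _ _ Hpsi Hl Hrt Hs' Hr N NF FH)
      as (psi' & h & Href & Hout & Einst & Fty & Fss).
    assert (Hused : forall Z, used U (P1 ++ (Flex F xs, Rig a ss) :: P2) phi Z -> ~ In Z Hs).
    { intros Z HZ HiZ. now apply (Hfr Z). }
    destruct (eqs_ext psi psi' (P1 ++ P2)) as [Hsol' Hsz]; auto.
    { intros X HX. apply Hout, Hused. right; left. auto. }
    assert (Ess : map (sapp psi') ss = map (sapp psi) ss).
    { apply map_ext_in. intros u Hu. apply sapp_ext. intros X HX. apply Hout, Hused.
      right; left. eexists; split; [exact Hine|]. right. simpl. apply existsb_exists; eauto. }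
    exists psi'. split; [constructor|].
    + apply wf_compose; auto. apply Href.
    + apply Href.
    + eapply refines_compose; eauto.
    + intros Y HU HV. unfold compose. rewrite Hdom by auto.
      rewrite sapp_etaX by exact (proj1 (proj1 Href)). unfold upd.
      destruct (fvar_eq_dec Y F) as [->|]; auto.
      exfalso. apply HV, Heqs; auto. eexists; split; [exact Hine|]. left. now apply fvar_eqb_spec.
    + intros Y ([l r] & He' & HY) HU. apply in_app_iff in He' as [He'|He'].
      * simpl in HY. destruct HY as [HY|HY].
        -- apply in_combine_l, in_map_iff in He' as (H & <- & HH).
           rewrite occb_eta_app in HY. apply fvar_eqb_spec in HY as ->.
           exfalso. apply (Hfr H HH). left. auto.
        -- apply in_combine_r in He'. apply Heqs; auto. eexists; split; [exact Hine|].
           right. simpl. apply existsb_exists; eauto.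
      * apply Heqs; auto. apply Hin. exists (l, r). auto.
    + apply Forall_app. split; auto. eapply solved_combine; eauto. rewrite Ess.
      rewrite Einst in Hs'. simpl in Hs'. apply sim_Rig_inv in Hs' as (g & us & [= <- <-] & _ & F2).
      exact F2.
    + rewrite esize_middle, esize_app, Hsz, esize_combine by (rewrite length_map; auto).
      simpl. rewrite Einst. rewrite Ess. simpl. lia.
  - destruct He as (Ga & T & Hl & Hrt & Hs'). simpl in Hl, Hrt, Hs'.
    assert (HF : used_eqs (P1 ++ (Flex F xs, Flex G ys) :: P2) F).
    { eexists; split; [exact Hine|]. left. now apply fvar_eqb_spec. }
    assert (HG : used_eqs (P1 ++ (Flex F xs, Flex G ys) :: P2) G).
    { eexists; split; [exact Hine|]. right. now apply fvar_eqb_spec. }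
    destruct (distinct_vars_refines psi F xs G ys H Ga T) as (psi' & Href); auto.
    { intros ->. apply Hfr. right; left; auto. }
    { intros ->. apply Hfr. right; left; auto. }
    assert (Hused : forall Z, used U (P1 ++ (Flex F xs, Flex G ys) :: P2) phi Z -> Z <> H).
    { intros Z HZ ->. auto. }
    destruct (refines_eqs _ _ _ _ (P1 ++ P2) Href) as [Hsol' Hsz]; auto.
    { intros X HX. apply Hused. right; left. auto. }
    exists psi'. split; [constructor|].
    + apply wf_compose; auto. apply Href.
    + apply Href.
    + eapply refines_compose; eauto.
    + intros Y HU HV. unfold compose. rewrite Hdom by auto.
      rewrite sapp_etaX by exact (proj1 (proj1 Href)). unfold upd2.
      destruct (fvar_eq_dec Y F) as [->|]; [exfalso; apply HV, Heqs; auto|].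
      destruct (fvar_eq_dec Y G) as [->|]; [exfalso; apply HV, Heqs; auto|]. auto.
    + intros Y HY HU. apply used_eqs_map in HY as (Z & HZ & HY). unfold upd2 in HY.
      assert (NH : Y <> H) by (intros ->; apply Hfr; left; auto).
      destruct (fvar_eq_dec Z F) as [->|].
      { unfold ve2_bindingF in HY. rewrite occb_lams in HY. apply fvar_eqb_spec in HY. tauto. }
      destruct (fvar_eq_dec Z G) as [->|].
      { unfold ve2_bindingG in HY. rewrite occb_lams in HY. apply fvar_eqb_spec in HY. tauto. }
      unfold etaX in HY. rewrite occb_eta_app in HY. apply fvar_eqb_spec in HY as ->.
      apply Heqs; auto.
    + exact Hsol'.
    + rewrite Hsz, esize_middle. simpl. pose proof (size_pos (inst (psi F) xs)). lia.
Qed.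

Lemma ve_sound U V psi0 c c' :
  clos_refl_trans_1n _ (ve_step U) c c' -> forall psi,
  ve_inv U V psi0 (fst c) (snd c) psi -> exists psi', ve_inv U V psi0 (fst c') (snd c') psi'.
Proof using HRA HD.
  induction 1 as [|[P phi] [P' phi'] c Hs _ IH]; intros psi Hi; eauto.
  destruct (ve_step_sound _ _ _ _ _ _ _ _ Hi Hs) as (psi' & Hi' & _). eauto.
Qed.

(** The body of [psi F] is closed up to its own binders, so a bound variable heading its instance
    must be one of [xs]. This discharges the side conditions on rigid heads in VE1, LF and Ori. *)
Lemma rigid_in_exists psi F xs a ss G T :
  wf_subst psi -> has_type G (Flex F xs) T -> has_type G (Rig a ss) T ->
  sim (inst (psi F) xs) (sapp psi (Rig a ss)) ->
  exists a' Ta, rigid_in xs (args_of (snd F)) a a' Ta /\ length (args_of Ta) = length ss.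
Proof using HRA HD.
  intros Hpsi Hx Ha Hs.
  apply has_type_Flex_inv in Hx as (-> & Nx & Fx). assert (Lx := Forall2_length Fx).
  apply has_type_Rig_inv in Ha as (A1 & HA1 & ET & Fss).
  destruct (closed_lams _ _ (proj1 Hpsi F)) as (b & Eb & Hb).
  rewrite Eb, inst_lams in Hs by auto. simpl in Hs.
  destruct b as [A b|h cs|X zs]; simpl in Hs; inversion Hs as [|h1 h2 l1 l2 Hh Hl|]; subst.
  apply has_type_Rig_inv in Hb as (A & HA & _ & Fcs).
  apply Forall2_length in Fss.
  destruct a as [c|j].
  - exists (HC c), (snd c). simpl in HA1. subst. split; [constructor|auto].
  - apply hsim_sym, hsim_HB in Hh. destruct h as [c|i]; simpl in Hh; [discriminate|].
    injection Hh as Ej. simpl in HA, HA1.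
    assert (Hi : i < length (args_of (snd F))).
    { rewrite <- length_rev. apply nth_error_Some. congruence. }
    (* [RI_B] wants an index of the form [length xs - 1 - k]; the argument position is
       [k = length xs - 1 - i]. *)
    exists (HB (length xs - 1 - (length xs - 1 - i))), A1. split; [|auto].
    rewrite <- Ej in HA1. rewrite (ins_lookup _ _ _ _ _ Fx HA) in HA1. injection HA1 as <-.
    constructor.
    + rewrite (nth_error_nth' xs 0) by lia. f_equal. rewrite <- Ej. unfold ins.
      destruct (Nat.ltb_spec i (length xs)); [auto|lia].
    + now rewrite nth_error_rev_sub, <- Lx in HA by auto.
Qed.

Lemma rigid_in_ok xs As a a' T : rigid_in xs As a a' T -> rigid_ok xs a.
Proof using. inversion 1; simpl; auto. eapply nth_error_In; eauto. Qed.

(** Solvability excludes clashes and foreign bound variables, while [ve_linear] excludes the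
    equations that no rule of VarElim covers. The shape persists because fresh variables head the
    new left-hand sides and occur nowhere else. *)
Lemma ve_progress U V psi0 e P phi psi :
  finite_set U -> ve_inv U V psi0 (e :: P) phi psi -> ve_linear (e :: P) ->
  exists P' phi', ve_step U (e :: P, phi) (P', phi') /\ ve_linear P'.
Proof using HRA HD.
  intros Hfin [Hphi Hpsi _ _ _ Hsol] [Hh [Hnd Hocc]].
  assert (Hufin := used_finite U (e :: P) phi Hfin Hphi).
  inversion Hsol as [|? ? He HsolP]; subst. destruct e as [l r].
  destruct He as (G & T & Hl & Hr & Hs). simpl in Hl, Hr, Hs.
  assert (HheadP : forall X e, In e ((l, r) :: P) -> lhead (fst e) = Some X ->
    used U ((l, r) :: P) phi X).
  { intros X e He EX. right; left. exists e. split; auto. left. now apply lhead_occb. }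
  destruct l as [A t|h ts|F xs].
  - apply has_type_Lam_inv in Hl as (B & -> & Hl).
    destruct r as [A' s|h ss|Y ys].
    + apply has_type_Lam_inv in Hr as (B' & E & Hr). injection E as <- <-.
      exists ((t, s) :: P), phi. split; [apply (VE_Abs U [] P)|]. split; [|split].
      * intros e [<-|He]; [apply (Hh (Lam A t, Lam A s)) | apply Hh]; simpl; auto.
      * exact Hnd.
      * intros e1 e2 X H1 H2 EX.
        assert (exists e1', In e1' ((Lam A t, Lam A s) :: P) /\ lhead (fst e1') = Some X)
          as (e1' & H1' & EX').
        { destruct H1 as [<-|H1]; [exists (Lam A t, Lam A s) | exists e1]; simpl; auto. }
        destruct H2 as [<-|H2].
        -- apply (Hocc e1' (Lam A t, Lam A s)); simpl; auto.
        -- apply (Hocc e1' e2); simpl; auto.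
    + apply has_type_Rig_inv in Hr as (? & _ & ? & _). discriminate.
    + apply has_type_Flex_inv in Hr as (? & _). discriminate.
  - exfalso. apply (Hh (Rig h ts, r)); simpl; auto.
  - assert (ET := Hl). apply has_type_Flex_inv in ET as (ET & _ & _).
    destruct r as [A' s|a ss|F' ys].
    + apply has_type_Lam_inv in Hr as (B & -> & _). discriminate.
    + destruct (rigid_in_exists _ _ _ _ _ _ _ Hpsi Hl Hr Hs) as (a' & Ta & Hri & Lss).
      destruct (fresh_list _ Hufin (map (arrows (args_of (snd F))) (args_of Ta)))
        as (Hs' & N & Hfr & EHs).
      assert (LHs : length Hs' = length ss).
      { assert (E := f_equal (@length ty) EHs). rewrite !length_map in E.
        exact (eq_trans E Lss). }
      assert (FH : Forall2 (fun H rho => snd H = arrows (args_of (snd F)) rho) Hs' (args_of Ta)).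
      { apply (Forall2_maps eq snd (arrows (args_of (snd F)))). rewrite EHs.
        apply Forall2_map_same, Forall_forall. auto. }
      do 2 eexists. split; [apply (VE_1 U [] P F xs a ss phi a' Ta Hs'); auto|].
      rewrite Forall_forall in Hfr. simpl app.
      inversion Hnd as [|? ? Hnd1 Hnd2]; subst.
      assert (Ehd : map (fun e => lhead (fst e))
        (combine (map (fun H => eta_app H xs) Hs') ss ++ P) =
        map Some Hs' ++ map (fun e => lhead (fst e)) P).
      { rewrite map_app. f_equal. clear - LHs. revert ss LHs.
        induction Hs' as [|H Hs' IH]; intros [|s ss] L; simpl in *; try discriminate; auto.
        f_equal; auto. apply lhead_eta_app. }
      assert (Hcases : forall o,
        In o (map (fun e => lhead (fst e)) (combine (map (fun H => eta_app H xs) Hs') ss ++ P)) ->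
        (exists H, In H Hs' /\ o = Some H) \/ In o (map (fun e => lhead (fst e)) P)).
      { intros o Ho. rewrite Ehd, in_app_iff, in_map_iff in Ho.
        destruct Ho as [(H & <- & HH)|Ho]; eauto. }
      split; [|split].
      * intros e He E. apply in_map with (f := fun e => lhead (fst e)) in He. rewrite E in He.
        apply Hcases in He as [(H & _ & E')|He]; [discriminate|].
        apply in_map_iff in He as (e' & E' & He'). apply (Hh e'); simpl; auto.
      * rewrite Ehd. apply NoDup_app; auto.
        -- apply NoDup_map_NoDup_ForallPairs; auto. intros x y _ _. congruence.
        -- intros o Ho Ho'. apply in_map_iff in Ho as (H & <- & HH).
           apply in_map_iff in Ho' as (e' & E' & He'). apply (Hfr H HH).
           apply (HheadP H e'); simpl; auto.
      * intros e1 e2 X H1 H2 EX. apply not_true_is_false. intros HX.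
        assert (exists e0, In e0 ((Flex F xs, Rig a ss) :: P) /\ occb X (snd e0) = true)
          as (e0 & He0 & HX0).
        { apply in_app_iff in H2 as [H2|H2].
          - exists (Flex F xs, Rig a ss). split; simpl; auto. destruct e2 as [l2 r2].
            apply in_combine_r in H2. apply existsb_exists; eauto.
          - exists e2. simpl; auto. }
        apply in_map with (f := fun e => lhead (fst e)) in H1. rewrite EX in H1.
        apply Hcases in H1 as [(H & HH & [= <-])|H1].
        -- apply (Hfr X HH). right; left. exists e0. auto.
        -- apply in_map_iff in H1 as (e' & E' & He').
           rewrite (Hocc e' e0 X) in HX0; simpl; auto. discriminate.
    + assert (NFF : F <> F').
      { intros <-. assert (Q := Hocc (Flex F xs, Flex F ys) (Flex F xs, Flex F ys) F).
        simpl in Q. rewrite (proj2 (fvar_eqb_spec F F)) in Q by auto.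
        discriminate Q; auto. }
      destruct (fresh_list _ Hufin [pos_type F (ve2_pos xs ys)]) as (Hs' & _ & Hfr & EHs).
      destruct Hs' as [|H [|]]; try discriminate. injection EHs as EH.
      inversion Hfr as [|? ? HH _]; subst.
      do 2 eexists. split; [apply (VE_2 U [] P F xs F' ys H phi); auto|]. simpl app.
      set (th := upd2 _ _ _ _).
      inversion Hnd as [|? ? Hnd1 Hnd2]; subst.
      (* The binding changes no other left head: [F] already heads the selected equation and heads
         are distinct, and [F'] occurs on a right-hand side. *)
      assert (Hth : forall e X, In e P -> lhead (fst e) = Some X -> X <> F /\ X <> F').
      { intros e X He EX. split; intros ->.
        - apply Hnd1. apply in_map_iff. exists e. simpl. auto.
        - assert (Q := Hocc e (Flex F xs, Flex F' ys) F').
          simpl in Q. rewrite (proj2 (fvar_eqb_spec F' F')) in Q by auto.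
          discriminate Q; auto. }
      assert (Hhd : forall e, In e P -> lhead (fst (eapp th e)) = lhead (fst e)).
      { intros e He. destruct (lhead (fst e)) as [X|] eqn:EX; [|destruct (Hh e); simpl; auto].
        rewrite Forall_forall in HsolP. destruct (HsolP e He) as (G' & T' & Hty & _).
        eapply lhead_sapp; eauto. unfold th, upd2. destruct (Hth e X He EX).
        destruct (fvar_eq_dec X F); [tauto|]. destruct (fvar_eq_dec X F'); tauto. }
      split; [|split].
      * intros e' He'. apply in_map_iff in He' as (e & <- & He). rewrite Hhd by auto.
        apply Hh; simpl; auto.
      * rewrite map_map. erewrite map_ext_in; [exact Hnd2|]. auto.
      * intros e1' e2' X H1 H2 EX. apply in_map_iff in H1 as (e1 & <- & H1).
        apply in_map_iff in H2 as (e2 & <- & H2). rewrite Hhd in EX by auto.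
        apply not_true_is_false. intros HX. simpl in HX.
        apply occb_sapp in HX as (Z & HZ & HX).
        assert (NXH : X <> H).
        { intros ->. apply HH. apply (HheadP H e1); simpl; auto. }
        unfold th, upd2 in HX.
        destruct (fvar_eq_dec Z F) as [->|].
        { unfold ve2_bindingF in HX. rewrite occb_lams in HX. apply fvar_eqb_spec in HX. tauto. }
        destruct (fvar_eq_dec Z F') as [->|].
        { unfold ve2_bindingG in HX. rewrite occb_lams in HX. apply fvar_eqb_spec in HX. tauto. }
        unfold etaX in HX. rewrite occb_eta_app in HX. apply fvar_eqb_spec in HX as ->.
        rewrite (Hocc e1 e2 Z) in HZ; simpl; auto. discriminate.
Qed.

Lemma ve_complete U V psi0 n : forall P phi psi,
  finite_set U -> ve_inv U V psi0 P phi psi -> ve_linear P -> esize psi P <= n ->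
  exists phi', clos_refl_trans_1n _ (ve_step U) (P, phi) ([], phi').
Proof using HRA HD.
  induction n as [|n IH]; intros [|e P] phi psi Hfin Hi Hl Hn;
    try (exists phi; constructor).
  - exfalso. unfold esize in Hn. simpl in Hn. pose proof (size_pos (sapp psi (fst e))). lia.
  - destruct (ve_progress _ _ _ _ _ _ _ Hfin Hi Hl) as (P' & phi' & Hs & Hl').
    destruct (ve_step_sound _ _ _ _ _ _ _ _ Hi Hs) as (psi' & Hi' & Hlt).
    destruct (IH P' phi' psi') as (phi'' & Hc); auto; [lia|].
    exists phi''. econstructor; eauto.
Qed.

Lemma ve_inv_start U psi F xs u :
  wf_subst psi -> solved psi (Flex F xs, u) ->
  ve_inv U (fun X => fvar_eqb X F || occb X u = true) psi [(Flex F xs, u)] eps psi.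
Proof using HRA HD.
  intros Hpsi He. constructor; auto.
  - apply wf_eps.
  - intros Y _. unfold eps. rewrite sapp_etaX by exact (proj1 Hpsi). apply sim_refl.
  - intros Y (e & [<-|[]] & HY) _. simpl in HY. destruct HY as [-> | ->]; auto.
    apply orb_true_r.
Qed.

(** On [U] the restricted substitution equals [phi], which is the identity there outside the
    starting equation; restriction can only change values at variables outside [U]. *)
Lemma VarElim_refines U psi F xs u phi :
  wf_subst psi -> solved psi (Flex F xs, u) -> VarElim U (Flex F xs) u phi ->
  exists psi', refines psi (lf_sub F u phi) psi' U.
Proof using HRA HD.
  intros Hpsi He Hve.
  destruct (ve_sound _ _ _ _ _ Hve _ (ve_inv_start U _ _ _ _ Hpsi He)) as (psi' & Hi).
  destruct Hi as [Hphi Hpsi' Hsim Hdom _ _]. simpl in *.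
  exists psi'. split; [|split; auto].
  - destruct Hphi as [Hty [l Hl]]. unfold lf_sub, restrict. split.
    + intros X. destruct (_ || _); auto. apply etaX_typed.
    + exists l. intros X HX. destruct (_ || _); auto.
  - intros Y HY. assert (E : lf_sub F u phi Y = phi Y).
    { unfold lf_sub, restrict. destruct (_ || _) eqn:EV; auto. symmetry. apply Hdom; auto.
      rewrite EV. discriminate. }
    rewrite E. auto.
Qed.

Lemma VarElim_exists U psi F xs u :
  finite_set U -> wf_subst psi -> solved psi (Flex F xs, u) -> occb F u = false ->
  exists phi, VarElim U (Flex F xs) u phi.
Proof using HRA HD.
  intros Hfin Hpsi He HF. unfold VarElim. eapply ve_complete; eauto using ve_inv_start.
  split; [|split].
  - intros e [<-|[]]. simpl. discriminate.
  - constructor; simpl; auto. constructor.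
  - intros e e' X [<-|[]] [<-|[]] [= <-]. auto.
Qed.

(** * The algorithm *)

Section Algorithm.
Context (mu : R) (Hmu : (D >= mu)%R) (avoid : list fvar) (tau : subst).

Record inv (P : list eqn) (sg : subst) (d : R) (psi : subst) : Prop := {
  inv_sg : wf_subst sg;
  inv_psi : wf_subst psi;
  inv_deg : (d >= D)%R;
  inv_sim : forall Y, In Y avoid -> sim (sapp psi (sg Y)) (tau Y);
  inv_solved : Forall (solved psi) P
}.

Lemma inv_refines P1 e P2 sg d psi th psi' W :
  inv (P1 ++ e :: P2) sg d psi -> refines psi th psi' W ->
  (forall Z, used (fun X => In X avoid) (P1 ++ e :: P2) sg Z -> W Z) ->
  inv (map (eapp th) (P1 ++ P2)) (compose sg th) d psi' /\
  esize psi' (map (eapp th) (P1 ++ P2)) < esize psi (P1 ++ e :: P2).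
Proof using HRA HD.
  intros [Hsg Hpsi Hd Hsim Hsol] Href HW.
  apply Forall_app in Hsol as [Hs1 Hs2]. inversion Hs2; subst.
  destruct (refines_eqs _ _ _ _ (P1 ++ P2) Href) as [Hsol' Hsz].
  { apply Forall_app; auto. }
  { intros X (e' & He' & HX). apply HW. right; left. exists e'. split; auto.
    rewrite in_app_iff in *. simpl. tauto. }
  split.
  - constructor; auto.
    + apply wf_compose; auto. apply Href.
    + apply Href.
    + eapply (refines_compose (fun X => In X avoid)); eauto.
  - rewrite Hsz, esize_middle. pose proof (size_pos (sapp psi (fst e))). lia.
Qed.

(** Holds for any selected equation, any applicable rule and any fresh names, so no choice made
    during a run can lose the solution. *)
Lemma rule_sound P1 e P2 sg d psi c :
  inv (P1 ++ e :: P2) sg d psi -> rule RA mu avoid P1 e P2 sg d c ->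
  exists P' sg' d' psi', c = Some (P', sg', d') /\ inv P' sg' d' psi' /\
    (esize psi' P' < esize psi (P1 ++ e :: P2) \/
     esize psi' P' = esize psi (P1 ++ e :: P2) /\
     rig_count P' < rig_count (P1 ++ e :: P2)).
Proof using HRA HD.
  intros Hi Hr. assert (Hi' := Hi). destruct Hi' as [Hsg Hpsi Hd Hsim Hsol].
  apply Forall_app in Hsol as [Hs1 Hs2]. inversion Hs2 as [|? ? He Hs3]; subst.
  assert (HsP : Forall (solved psi) (P1 ++ P2)) by (apply Forall_app; auto).
  inversion Hr; subst; clear Hr.
  - apply solved_abs in He as [_ He]. do 4 eexists; split; [reflexivity|]. split.
    + constructor; eauto.
    + left. rewrite esize_middle, esize_cons. simpl. lia.
  - destruct He as (G & T & Hl & Hrt & Hs). simpl in Hl, Hrt, Hs.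
    apply has_type_Rig_inv in Hl as (A & HA & -> & F1).
    apply has_type_Rig_inv in Hrt as (B & HB & E & F2).
    apply sim_Rig_inv in Hs as (g' & ss' & [= <- <-] & Hh & Fs).
    (* Similar heads have the same type, so the paired arguments are typed alike. *)
    assert (A = B) as <-.
    { apply head_type_hsim with (2 := Hh) in HA. destruct g; simpl in *; congruence. }
    do 4 eexists; split; [reflexivity|]. split.
    + constructor; eauto.
      * now apply Rmin_ge_iff.
      * apply Forall_app. split; auto. eapply solved_combine; eauto.
    + left. rewrite esize_middle, esize_app, esize_combine by auto. simpl. lia.
  - destruct He as (G & T & Hl & Hrt & Hs). simpl in Hl, Hrt, Hs.
    destruct (same_var_refines psi F xs ys H G T) as (psi' & Href); auto.
    { intros ->. apply H2. right; left. eexists; split; [apply in_elt|]. left.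
      now apply fvar_eqb_spec. }
    destruct (inv_refines _ _ _ _ _ _ _ _ _ Hi Href) as [Hinv Hlt].
    { intros Z HZ ->. auto. }
    do 4 eexists; split; [reflexivity|]. split; [exact Hinv|]. auto.
  - destruct He as (G & T & Hl & Hrt & Hs). do 4 eexists; split; [reflexivity|]. split.
    + constructor; eauto. constructor; auto. exists G, T. repeat split; auto using sim_sym.
    + right. rewrite esize_middle, esize_cons, rig_count_middle. simpl. split; [lia|].
      unfold rig_count. simpl. lia.
  - destruct (VarElim_refines _ _ _ _ _ _ Hpsi He H2) as (psi' & Href).
    destruct (inv_refines _ _ _ _ _ _ _ _ _ Hi Href) as [Hinv Hlt]; auto.
    do 4 eexists; split; [reflexivity|]. split; [exact Hinv|]. auto.
Qed.

(** This is what disables Fail: whichever equation is selected, the solution supplies the side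
    conditions of some other rule. *)
Lemma rule_exists P1 e P2 sg d psi :
  inv (P1 ++ e :: P2) sg d psi -> exists c, rule RA mu avoid P1 e P2 sg d c.
Proof using HRA HD Hmu.
  intros [Hsg Hpsi Hd Hsim Hsol].
  apply Forall_app in Hsol as [_ Hs2]. inversion Hs2 as [|? ? He _]; subst.
  assert (Hfin : finite_set (used (fun X => In X avoid) (P1 ++ e :: P2) sg)).
  { apply used_finite; auto. exists avoid. auto. }
  destruct e as [l r]. assert (He' := He). destruct He' as (G & T & Hl & Hr & Hs).
  simpl in Hl, Hr, Hs.
  assert (Hlam : forall A t, l = Lam A t -> exists s, r = Lam A s).
  { intros A t ->. apply has_type_Lam_inv in Hl as (B & -> & _).
    destruct r as [A' s|h ss|Y ys].
    - apply has_type_Lam_inv in Hr as (B' & [= <- <-] & _). eauto.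
    - apply has_type_Rig_inv in Hr as (? & _ & ? & _). discriminate.
    - apply has_type_Flex_inv in Hr as (? & _). discriminate. }
  assert (Hnlam : forall A t, r = Lam A t -> exists s, l = Lam A s).
  { intros A t ->. apply has_type_Lam_inv in Hr as (B & -> & _).
    destruct l as [A' s|h ss|Y ys].
    - apply has_type_Lam_inv in Hl as (B' & [= <- <-] & _). eauto.
    - apply has_type_Rig_inv in Hl as (? & _ & ? & _). discriminate.
    - apply has_type_Flex_inv in Hl as (? & _). discriminate. }
  destruct l as [A t|h ts|F xs].
  - destruct (Hlam A t eq_refl) as (s & ->). eexists. eapply R_Abs. reflexivity.
  - destruct r as [A s|g ss|F ys].
    + destruct (Hnlam A s eq_refl). discriminate.
    + apply sim_Rig_inv in Hs as (g' & ss' & [= <- <-] & Hh & F).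
      apply Forall2_length in F. rewrite !length_map in F.
      eexists. eapply R_Dec; eauto.
      (* Both degrees are at least [D], and [D >= mu], so the guard of Dec holds. *)
      assert (Rmin d (Rh RA h g) >= D)%R by now apply Rmin_ge_iff. lra.
    + apply sim_sym in Hs.
      destruct (rigid_in_exists _ _ _ _ _ _ _ Hpsi Hr Hl Hs) as (a' & Ta & Hri & _).
      eexists. apply R_Ori with (a := h); eauto using rigid_in_ok.
  - destruct r as [A s|g ss|F' ys].
    + destruct (Hnlam A s eq_refl). discriminate.
    + destruct (rigid_in_exists _ _ _ _ _ _ _ Hpsi Hl Hr Hs) as (a' & Ta & Hri & _).
      (* Occurs check by size: an argument containing [F] would have an instance at least as large
         as the body of [psi F], making the whole right-hand side strictly larger than a term
         similar to it. *)
      assert (HF : occb F (Rig g ss) = false).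
      { apply not_true_is_false. intros HF.
        apply existsb_exists in HF as (u & Hu & HF).
        destruct (rig_arg_typed _ _ _ _ _ Hr Hu) as (B & HB).
        assert (Hle := size_sapp_occb psi F u _ _ HB HF).
        apply sim_size in Hs. cbn [sapp] in Hs. unfold inst in Hs. rewrite size_rename in Hs.
        apply has_type_Flex_inv in Hl as (_ & _ & Fx). rewrite (Forall2_length Fx) in Hs.
        apply in_split in Hu as (l1 & l2 & ->).
        simpl in Hs. rewrite !map_app, list_sum_app in Hs. simpl in Hs. lia. }
      destruct (VarElim_exists _ _ _ _ _ Hfin Hpsi He HF) as (phi & Hphi).
      eexists. eapply R_LF; eauto. simpl. eauto using rigid_in_ok.
    + destruct (fvar_eq_dec F F') as [<-|NFF].
      * destruct (fresh_list _ Hfin [pos_type F (sv_pos xs ys)]) as (Hs' & _ & Hfr & EHs).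
        destruct Hs' as [|H [|]]; try discriminate. injection EHs as EH.
        inversion Hfr as [|? ? HH _]; subst.
        eexists. eapply R_SV; eauto.
        apply has_type_Flex_inv in Hl as (_ & _ & F1), Hr as (_ & _ & F2).
        apply Forall2_length in F1, F2. congruence.
      * assert (HF : occb F (Flex F' ys) = false).
        { apply not_true_is_false. intros HF. now apply fvar_eqb_spec in HF. }
        destruct (VarElim_exists _ _ _ _ _ Hfin Hpsi He HF) as (phi & Hphi).
        eexists. eapply R_LF; eauto. exact I.
Qed.

Lemma step_sound P sg d psi c :
  inv P sg d psi -> step RA mu avoid (Some (P, sg, d)) c ->
  exists P' sg' d' psi', c = Some (P', sg', d') /\ inv P' sg' d' psi' /\
    (esize psi' P' < esize psi P \/
     esize psi' P' = esize psi P /\ rig_count P' < rig_count P).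
Proof using HRA HD Hmu.
  intros Hi Hs. inversion Hs as [P1 e P2 sg0 d0 c0 Hr E|P1 e P2 sg0 d0 Hn E]; subst.
  - eapply rule_sound; eauto.
  - destruct (rule_exists _ _ _ _ _ _ Hi) as (c & Hc). now destruct (Hn c).
Qed.

(** Lexicographic descent on [esize] and then [rig_count]. The solution, and with it the measure,
    may change at each step, so [psi] is quantified inside the induction. *)
Lemma step_terminates n : forall m P sg d psi,
  inv P sg d psi -> esize psi P <= n -> rig_count P <= m ->
  Acc (fun c2 c1 => step RA mu avoid c1 c2) (Some (P, sg, d)).
Proof using HRA HD Hmu.
  induction n as [n IHn] using lt_wf_ind. induction m as [m IHm] using lt_wf_ind.
  intros P sg d psi Hi Hn Hm. constructor. intros c Hs.
  destruct (step_sound _ _ _ _ _ Hi Hs) as (P' & sg' & d' & psi' & -> & Hi' & [Hlt|[Heq Hlt]]).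
  - apply (IHn (esize psi' P')) with (m := rig_count P') (psi := psi'); auto; lia.
  - apply (IHm (rig_count P')) with (psi := psi'); auto; lia.
Qed.

Lemma steps_sound c c' :
  clos_refl_trans_1n _ (step RA mu avoid) c c' -> forall P sg d psi,
  c = Some (P, sg, d) -> inv P sg d psi ->
  exists P' sg' d' psi', c' = Some (P', sg', d') /\ inv P' sg' d' psi'.
Proof using HRA HD Hmu.
  induction 1 as [|c1 c2 c3 Hs _ IH]; intros P sg d psi -> Hi; eauto 6.
  destruct (step_sound _ _ _ _ _ Hi Hs) as (P' & sg' & d' & psi' & -> & Hi' & _). eauto.
Qed.

Lemma normal_form_empty P sg d psi :
  inv P sg d psi -> (forall c, ~ step RA mu avoid (Some (P, sg, d)) c) -> P = [].
Proof using HRA HD Hmu.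
  intros Hi Hn. destruct P as [|e P]; auto. exfalso.
  destruct (rule_exists [] e P sg d psi Hi) as (c & Hc).
  apply (Hn c). now apply (S_rule RA mu avoid [] e P).
Qed.

End Algorithm.
End Similarity.

(** * From the degree of the given unifier to all runs of the algorithm *)

(** Makes the degree of the unifier an admissible threshold: the run starts at degree 1, and
    reflexivity of the cut similarity requires [D <= 1]. *)
Lemma Rt_le_1 RA t : is_similarity RA -> forall s, (Rt RA t s <= 1)%R.
Proof.
  intros (Hb & _). induction t as [A t IH|h ts IH|X xs] using tm_nested_ind;
    intros [B s|g ss|Y ys]; simpl; try lra.
  - destruct (ty_eq_dec A B); auto; lra.
  - eapply Rle_trans; [apply Rmin_l|]. destruct h, g; simpl; try lra.
    + apply Hb.
    + destruct (Nat.eq_dec i i0); lra.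
  - destruct (fvar_eq_dec X Y); [|lra]. destruct (list_eq_dec Nat.eq_dec xs ys); lra.
Qed.

(** Accessibility of the reversed step relation expresses termination under every strategy, and the
    second part covers every irreducible configuration reached. The list [avoid] keeps fresh names
    off the domain of [tau], where the two substitutions are compared. *)
Theorem theorem4 (RA : cst -> cst -> R) (mu : R) (t s : tm) (T : ty)
  (tau : subst) (avoid : list fvar) :
  is_similarity RA ->
  (0 < mu <= 1)%R ->
  has_type [] t T -> has_type [] s T ->
  wf_subst tau ->
  (Rt RA (sapp tau t) (sapp tau s) >= mu)%R ->
  (forall X, in_dom tau X -> In X avoid) ->
  Acc (fun c2 c1 => step RA mu avoid c1 c2) (init_config t s) /\
  (forall c, clos_refl_trans _ (step RA mu avoid) (init_config t s) c ->
     (forall c', ~ step RA mu avoid c c') ->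
     exists sg d, c = Some ([], sg, d) /\
       more_general RA mu (in_dom tau) sg tau /\
       (d >= Rt RA (sapp tau t) (sapp tau s))%R).
Proof.
  intros HRA Hmu Ht Hs Htau HD Hav.
  set (D := Rt RA (sapp tau t) (sapp tau s)) in *.
  assert (HD1 : (D <= 1)%R) by now apply Rt_le_1.
  assert (HD01 : (0 < D <= 1)%R) by lra.
  assert (Hi : inv RA D avoid tau [(t, s)] eps 1 tau).
  { constructor; auto using wf_eps.
    - lra.
    - intros Y _. unfold eps. rewrite sapp_etaX by exact (proj1 Htau). apply sim_refl; auto.
    - constructor; auto. exists [], T. simpl. repeat split; auto.
      apply (Rt_sim RA D HD01). unfold D. lra. }
  split.
  - eapply (step_terminates RA D HRA HD01 mu HD avoid tau); eauto.
  - intros c Hc Hn. apply clos_rt_rt1n in Hc.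
    destruct (steps_sound RA D HRA HD01 mu HD avoid tau _ _ Hc _ _ _ _ eq_refl Hi)
      as (P & sg & d & psi & -> & Hi').
    assert (P = []) as -> by (eapply normal_form_empty; eauto).
    destruct Hi' as [_ Hpsi Hd Hsim _]. exists sg, d. split; [reflexivity|]. split; auto.
    (* The final solution is itself the matching substitution; it works at degree [D], hence at
       [mu]. *)
    exists psi. split; auto. intros X HX. specialize (Hsim X (Hav X HX)).
    apply (Rt_sim RA D HD01) in Hsim. lra.
Qed.
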